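(* For every $\gamma\in\mathbb C^N$ and $k\in\mathbb Z$, the map $$\mathbf d:\ M_{\rm Hyp}(\gamma)\otimes V_{\mathbb Z^N}^k\longrightarrow M_{\rm Hyp}(\gamma)\otimes V_{\mathbb Z^N}^{k+1}$$ is a homomorphism of modules over the Lie algebra $\mathrm{Vect}\,\mathbb T^{N+1}$ of vector fields on the $(N+1)$-dimensional torus.
   Context: Let $N\ge1$. $\mathrm{Vect}\,\mathbb T^{N+1}=\mathrm{Der}\,\mathbb C[t_0^{\pm1},\dots,t_N^{\pm1}]=\bigoplus_{a=0}^N\mathbb C[t_0^{\pm1},\dots,t_N^{\pm1}]d_a$, $d_a=t_a\partial/\partial t_a$; $t^r=t_1^{r_1}\cdots t_N^{r_N}$ for $r\in\mathbb Z^N$. Normal ordering: for $a(z)=\sum_j a_{(j)}z^{-j-1}$ put $a(z)_-=\sum_{j\ge0}a_{(j)}z^{-j-1}$, $a(z)_+=\sum_{j\le-1}a_{(j)}z^{-j-1}$, and $:a(z)b(z):\;=a(z)_+b(z)+(-1)^{p(a)p(b)}b(z)a(z)_-$, where $p$ is parity. Fock space: $M_{\rm Hyp}(\gamma)=q^\gamma\mathbb C[q_1^{\pm1},\dots,q_N^{\pm1}]\otimes\mathbb C[u_{pj},v_{pj}\mid 1\le p\le N,\ j\ge1]$ (purely even) with operators, for $j\ge1$, $u^p_{(-j)}=j u_{pj}$, $v^p_{(-j)}=jv_{pj}$ (multiplication), $u^p_{(j)}=\partial/\partial v_{pj}$, $v^p_{(j)}=\partial/\partial u_{pj}$, $u^p_{(0)}=0$,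 $v^p_{(0)}=q_p\partial/\partial q_p$; $u^p(z)=\sum_{j\in\mathbb Z} u^p_{(j)}z^{-j-1}$, $v^p(z)=\sum_{j\in\mathbb Z} v^p_{(j)}z^{-j-1}$; $\omega^{\rm Hyp}(z)=\sum_p:u^p(z)v^p(z):$; and $$Y(q^r,z)=q^r\exp\Big(\sum_{p=1}^N r_p\sum_{j\ge1}\tfrac{z^j}{j}u^p_{(-j)}\Big)\exp\Big(-\sum_{p=1}^N r_p\sum_{j\ge1}\tfrac{z^{-j}}{j}u^p_{(j)}\Big).$$ Fermions: $\mathrm{Cl}_N$ is the Lie superalgebra with odd basis $\varphi^p_{(j)},\psi^p_{(j)}$ ($1\le p\le N$, $j\in\mathbb Z$) and even central element $K$, with $[\varphi^a_{(m)},\psi^b_{(n)}]=\delta_{ab}\delta_{m,-n-1}K$ and $[\varphi^a_{(m)},\varphi^b_{(n)}]=[\psi^a_{(m)},\psi^b_{(n)}]=0$. $V_{\mathbb Z^N}$ is the $\mathrm{Cl}_N$-module generated by a vacuum vector $\mathbf 1$ with $K\mathbf 1=\mathbf 1$ and $\varphi^p_{(j)}\mathbf 1=\psi^p_{(j)}\mathbf 1=0$ for $j\ge0$ (the exterior algebra on $\varphi^p_{(j)},\psi^p_{(j)}$, $j\le-1$). $\varphi^p(z)=\sum_j\varphi^p_{(j)}z^{-j-1}$, $\psi^p(z)=\sum_j\psi^p_{(j)}z^{-j-1}$. $V_{\mathbb Z^N}^k$ is the subspace of fermionic degree $k$, where $\deg\varphi^p_{(j)}=1$, $\deg\psi^p_{(j)}=-1$,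 $\deg\mathbf 1=0$. Put $E^{ab}(z)=\;:\varphi^a(z)\psi^b(z):$ and $\omega^{\rm fer}(z)=\sum_{p=1}^N:\big(\frac{d}{dz}\varphi^p(z)\big)\psi^p(z):$. Module structure: with $\omega(z)=\omega^{\rm Hyp}(z)+\omega^{\rm fer}(z)$, $\mathrm{Vect}\,\mathbb T^{N+1}$ acts on each $M_{\rm Hyp}(\gamma)\otimes V_{\mathbb Z^N}^k$ by (for $a=1,\dots,N$, $r\in\mathbb Z^N$) $$\sum_{j}t_0^jt^rd_a\,z^{-j-1}\mapsto\; :v^a(z)Y(q^r,z):+\sum_{p=1}^N r_pE^{pa}(z)Y(q^r,z),$$ $$\sum_j t_0^jt^rd_0\,z^{-j-2}\mapsto -:\omega(z)Y(q^r,z):-\sum_{i,j=1}^N r_iu^j(z)E^{ij}(z)Y(q^r,z)+\sum_{p=1}^N r_p\Big(\tfrac{d}{dz}u^p(z)\Big)Y(q^r,z).$$ Differential of the chiral de Rham complex: $\mathbf d$ is the coefficient at $z^{-1}$ in $\sum_{p=1}^N v^p(z)\varphi^p(z)$. *)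

(* Defs.v *)
From mathcomp Require Import all_boot all_order all_algebra.
From mathcomp Require Import finmap multiset monalg.
From mathcomp Require Import boolp classical_sets fsbigop reals.
From mathcomp Require Export complex.

Set Implicit Arguments.
Unset Strict Implicit.
Unset Printing Implicit Defensive.

Import Order.TTheory GRing.Theory Num.Theory.

Local Open Scope classical_set_scope.
Local Open Scope ring_scope.

(* Fields.  A formal series a(z) = \sum_j a_(j) z^(-j-1) of operators on V is
   the function j |-> a_(j).  All the infinite sums of operators below have
   finitely many nonzero terms on each vector of the Fock space; they are
   written with the finite-support sums of fsbigop. *)

Section Fields.

Context {K : fieldType} {V : lmodType K}.

Definition series := int -> V -> V.

Definition sadd (a b : series) : series := fun n x => a n x + b n x.
Definition sscale (c : K) (a : series) : series := fun n x => c *: a n x.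
Definition ssum (I : finType) (a : I -> series) : series :=
  fun n x => \sum_i a i n x.

Definition sderiv (a : series) : series := fun n x => - n%:~R *: a (n - 1) x.

Definition smul (a b : series) : series :=
  fun n x => \sum_(j \in [set: int]) a j (b (n - 1 - j) x).

(* :a(z)b(z): for a and b of parities pa and pb (true = odd) *)
Definition nop (pa pb : bool) (a b : series) : series := fun n x =>
  \sum_(j \in [set j : int | j <= -1]) a j (b (n - 1 - j) x)
  + (-1) ^+ (pa && pb) *:
    \sum_(j \in [set j : int | 0 <= j]) b (n - 1 - j) (a j x).

(* Exponential of A(z) = \sum_(i >= 1) A_i z^i, where A i stands for A_(i+1):
   [pow_coef A k n] is the coefficient of z^n in A(z)^k, which is 0 for k > n,
   and [exp_coef A n] is the coefficient of z^n in exp(A(z)). *)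
Fixpoint pow_coef (A : nat -> V -> V) (k n : nat) (x : V) : V :=
  if k is k'.+1 then \sum_(i < n) A i (pow_coef A k' (n - i.+1)%N x)
  else if n == 0%N then x else 0.

Definition exp_coef (A : nat -> V -> V) (n : nat) (x : V) : V :=
  \sum_(k < n.+1) (k`!)%:R^-1 *: pow_coef A k n x.

End Fields.

Arguments series {K} V.

Section Fock.

Context {K : fieldType} {N : nat}.

Definition zvec := {ffun 'I_N -> int}.

(* Labels of the free generators, with k = j - 1 >= 0:
   bosonic:   inl (p, k) is u_{p,k+1},       inr (p, k) is v_{p,k+1};
   fermionic: inl (p, k) is phi^p_(-k-1),    inr (p, k) is psi^p_(-k-1). *)
Definition gen : Type := (('I_N * nat) + ('I_N * nat))%type.

(* (s, m, w) is the basis vector  q^(gamma + s) * m (x) w,  where m is a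
   monomial (multiset) in the u_{pj}, v_{pj}, and w is the ordered wedge
   product of a finite set of fermionic generators. *)
Definition bvec : Type := (zvec * {mset gen}%mset * {fset gen})%type.

Definition fock := {malg K[bvec]}.

Definition lin_ext (f : bvec -> fock) (x : fock) : fock :=
  \sum_(b <- msupp x) x@_b *: f b.

Definition qmul (r : zvec) : fock -> fock :=
  lin_ext (fun b => let: (s, m, w) := b in << (s + r, m, w) >>).

Definition qder (gamma : {ffun 'I_N -> K}) (p : 'I_N) : fock -> fock :=
  lin_ext (fun b => let: (s, m, w) := b in
    (gamma p + (s p)%:~R) *: << (s, m, w) >>).

Definition bmul (g : gen) : fock -> fock :=
  lin_ext (fun b => let: (s, m, w) := b in << (s, (g +` m)%mset, w) >>).

Definition bder (g : gen) : fock -> fock :=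
  lin_ext (fun b => let: (s, m, w) := b in
    (m g)%:R *: << (s, (m `\ g)%mset, w) >>).

Definition u (p : 'I_N) : series fock := fun j x =>
  match j with
  | Posz 0 => 0
  | Posz k.+1 => bder (inr (p, k)) x
  | Negz k => k.+1%:R *: bmul (inl (p, k)) x
  end.

Definition v (gamma : {ffun 'I_N -> K}) (p : 'I_N) : series fock := fun j x =>
  match j with
  | Posz 0 => qder gamma p x
  | Posz k.+1 => bder (inl (p, k)) x
  | Negz k => k.+1%:R *: bmul (inr (p, k)) x
  end.

(* Y(q^r, z) = q^r exp(A(z)) exp(B(z)), A(z) in z C[[z]], B(z) in
   z^-1 C[[z^-1]]; the sum is over the pairs (m, n) with z^m z^-n = z^(-j-1) *)
Definition vertexA (r : zvec) (k : nat) (x : fock) : fock :=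
  \sum_(p < N) ((r p)%:~R / k.+1%:R) *: u p (- k.+1%:Z) x.

Definition vertexB (r : zvec) (k : nat) (x : fock) : fock :=
  - \sum_(p < N) ((r p)%:~R / k.+1%:R) *: u p k.+1%:Z x.

Definition Y (r : zvec) : series fock := fun j x =>
  \sum_(mn \in [set mn : nat * nat | mn.1%:Z - mn.2%:Z = - j - 1])
    qmul r (exp_coef (vertexA r) mn.1 (exp_coef (vertexB r) mn.2 x)).

(* The order of the factors of a wedge product is that of [pickle]. *)
Definition fsign (g : gen) (w : {fset gen}) : K :=
  (-1) ^+ #|` [fset h in w | (choice.pickle h < choice.pickle g)%N]%fset|.

Definition fmul (g : gen) : fock -> fock :=
  lin_ext (fun b => let: (s, m, w) := b in
    if g \in w then 0 else fsign g w *: << (s, m, (g |` w)%fset) >>).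

Definition fder (g : gen) : fock -> fock :=
  lin_ext (fun b => let: (s, m, w) := b in
    if g \in w then fsign g w *: << (s, m, (w `\ g)%fset) >> else 0).

(* For j >= 0, phi^p_(j) kills the vacuum and its only nonzero anticommutator
   is the one with psi^p_(-j-1), so it is the contraction with psi^p_(-j-1);
   similarly for psi^p_(j). *)
Definition phi (p : 'I_N) : series fock := fun j =>
  match j with
  | Posz k => fder (inr (p, k))
  | Negz k => fmul (inl (p, k))
  end.

Definition psi (p : 'I_N) : series fock := fun j =>
  match j with
  | Posz k => fder (inl (p, k))
  | Negz k => fmul (inr (p, k))
  end.

Definition fdeg (b : bvec) : int :=
  \sum_(g <- b.2) (if g is inl _ then 1 else -1).

(* The subspace M_Hyp(gamma) (x) V_{Z^N}^k *)
Definition fock_deg (k : int) : set fock :=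
  [set x | forall b, b \in msupp x -> fdeg b = k].

Definition E (a b : 'I_N) : series fock := nop true true (phi a) (psi b).

Section Gamma.

Context (gamma : {ffun 'I_N -> K}).

Definition omega_hyp : series fock :=
  ssum (fun p => nop false false (u p) (v gamma p)).

Definition omega_fer : series fock :=
  ssum (fun p => nop true true (sderiv (phi p)) (psi p)).

Definition omega : series fock := sadd omega_hyp omega_fer.

(* The differential of the chiral de Rham complex *)
Definition dR : fock -> fock :=
  ssum (fun p => smul (v gamma p) (phi p)) 0.

(* \sum_j t_0^j t^r d_a z^(-j-1) and \sum_j t_0^j t^r d_0 z^(-j-2) *)
Definition field_d (a : 'I_N) (r : zvec) : series fock :=
  sadd (nop false false (v gamma a) (Y r))
       (ssum (fun p => sscale (r p)%:~R (smul (E p a) (Y r)))).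

Definition field_d0 (r : zvec) : series fock :=
  sadd (sadd
    (sscale (-1) (nop false false omega (Y r)))
    (sscale (-1) (ssum (fun i => ssum (fun j =>
       sscale (r i)%:~R (smul (smul (u j) (E i j)) (Y r)))))))
    (ssum (fun p => sscale (r p)%:~R (smul (sderiv (u p)) (Y r)))).

(* Vect T^(N+1): X is the vector field \sum_a X_a d_a, and the index (j, r) of
   a coefficient of X_a stands for t_0^j t^r. *)
Definition vect := {ffun 'I_N.+1 -> {malg K[(int * zvec)%type]}}.

Definition act_gen (a : 'I_N.+1) (jr : int * zvec) : fock -> fock :=
  if unlift ord0 a is Some p then field_d p jr.2 jr.1
  else field_d0 jr.2 (jr.1 + 1).

Definition act (X : vect) (x : fock) : fock :=
  \sum_(a < N.+1) \sum_(jr <- msupp (X a)) (X a)@_jr *: act_gen a jr x.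

(* f restricts to a homomorphism of Vect T^(N+1)-modules U -> W, for
   subspaces U and W of the Fock space *)
Definition vect_hom (U W : set fock) (f : fock -> fock) : Prop :=
  [/\ (forall X x, U x -> U (act X x)) /\ (forall X x, W x -> W (act X x)),
      forall x, U x -> W (f x),
      forall c x y, U x -> U y -> f (c *: x + y) = c *: f x + f y
    & forall X x, U x -> f (act X x) = act X (f x)].

End Gamma.

End Fock.

(* Main.v *)
From HB Require Import structures.
Require Import Defs.
From mathcomp Require Import all_boot all_order all_algebra.
From mathcomp Require Import finmap multiset monalg.
From mathcomp Require Import boolp classical_sets functions fsbigop reals.
From mathcomp Require Import zify ring.

Set Implicit Arguments.
Unset Strict Implicit.
Unset Printing Implicit Defensive.

Import Order.TTheory GRing.Theory Num.Theory.

Local Open Scope classical_set_scope.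
Local Open Scope ring_scope.

(** Write D for the differential, an odd operator of fermionic degree 1, and
    [D, a(z)] for its supercommutator with a field.  The theorem is true because
    every vector field acts on the Fock space by a D-exact operator.  Indeed
    Y = Y(q^r, z) satisfies

      [D, :psi^a(z) Y:] = :v^a(z) Y: + sum_p r_p E^{pa}(z) Y,
      [D, :tau(z) Y:] = :omega(z) Y: + sum_{i,j} r_i u^j(z) E^{ij}(z) Y
                        - sum_p r_p (d/dz u^p(z)) Y,  where tau = sum_p u^p psi^p,

    whose right-hand sides are the field of t^r d_a and minus the field of
    t^r d_0.  So each generator of the Lie algebra acts as D X + X D with X of
    fermionic degree -1.  Such an operator preserves the degree, and it commutes
    with D because D D = 0: both D (D X + X D) and (D X + X D) D are D X D.

    Both identities follow from the Leibniz rule [sder_nop] for D on normally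
    ordered products, once D is known on the generating fields:
    [D, u^p] = d/dz phi^p, [D, v^p] = 0, [D, phi^p] = 0, [D, psi^p] = v^p and
    [D, Y] = sum_p r_p phi^p Y.  The Leibniz rule produces iterated products
    such as :psi^a (phi^p Y):, which are regrouped by two rules.  [nop_smul]
    moves a factor commuting with the others out of a normally ordered product,
    without correction.  [nop_skew] exchanges the two factors of a normally
    ordered product; the correction it brings vanishes for psi and phi, and for
    u psi and phi it is the term d/dz u in the second identity.

    All of this uses only commutation relations, and is proved for operators on
    an arbitrary module.  What is specific to the Fock space is that its
    operators satisfy these relations and that the infinite sums are finite on
    each vector.  The relation [v^p_(j), Y(z)] = r_p z^j Y(z) ([v_Y]) comes from
    the first exponential of Y for j > 0, from the second one for j < 0, and
    from q^r for j = 0. *)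

(** * Linear maps *)

Section Linear.
Context {K : fieldType} {V : lmodType K}.
Implicit Types f g : V -> V.

Lemma lin_pack f : linear f -> exists2 F : {linear V -> V}, f = F & True.
Proof.
move=> lf; pose F : {linear V -> V} := HB.pack f (GRing.isLinear.Build K V V _ f lf).
by exists F.
Qed.

Lemma linD f : linear f -> {morph f : x y / x + y}.
Proof. by case/lin_pack=> F -> _; apply: raddfD. Qed.

Lemma lin0 f : linear f -> f 0 = 0.
Proof. by case/lin_pack=> F -> _; apply: raddf0. Qed.

Lemma linN f : linear f -> {morph f : x / - x}.
Proof. by case/lin_pack=> F -> _; apply: raddfN. Qed.

Lemma linZ f c : linear f -> {morph f : x / c *: x}.
Proof. by case/lin_pack=> F -> _ x; rewrite linearZ. Qed.

Lemma lin_sum f I (r : seq I) P (F : I -> V) : linear f ->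
  f (\sum_(i <- r | P i) F i) = \sum_(i <- r | P i) f (F i).
Proof. by case/lin_pack=> g -> _; apply: raddf_sum. Qed.

Lemma lin_comp f g : linear f -> linear g -> linear (fun x => f (g x)).
Proof. by move=> lf lg c x y; rewrite lg lf. Qed.

Lemma lin_add f g : linear f -> linear g -> linear (fun x => f x + g x).
Proof. by move=> lf lg c x y; rewrite lf lg scalerDr addrACA. Qed.

Lemma lin_scale c : linear (fun x : V => c *: x).
Proof. by move=> d x y; rewrite scalerDr !scalerA mulrC. Qed.

Lemma lin_sum_fun (I : Type) (r : seq I) (P : pred I) (F : I -> V -> V) :
  (forall i, linear (F i)) -> linear (fun x => \sum_(i <- r | P i) F i x).
Proof.
move=> lF c x y; rewrite scaler_sumr -big_split /=.
by apply: eq_bigr => i _; rewrite lF.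
Qed.

End Linear.

(** * Sums over the integers *)
Section IntSum.

Section Zmod.
Context {V : zmodType}.
Implicit Types F G : int -> V.

(** Products of fields are split into modes as sums over all of the integers:
    a normally ordered product then needs no separate treatment of its two
    halves. *)
Definition zsum F : V := \sum_(j \in [set: int]) F j.

(** A sum over an infinite support is 0 by convention, so that [zsum] is
    additive and commutes with linear maps only on families of finite support.
    Two bounds are the convenient form of this condition: for a product of
    fields each of the two factors provides one of them. *)
Definition zbounded F :=
  exists m M : int, forall j, (j < m) || (M <= j) -> F j = 0.

Lemma zsum_seq (r : seq int) F : uniq r -> (forall j, j \notin r -> F j = 0) ->
  zsum F = \sum_(j <- r) F j.
Proof.
move=> ur h; rewrite /zsum (fsbigE r) //; last by move=> i _; apply: h.
by apply: eq_bigl => i; rewrite in_setT.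
Qed.

Definition zwindow (B : nat) : seq int := [seq i%:Z - B%:Z | i <- iota 0 B.*2].

Lemma zwindow_uniq B : uniq (zwindow B).
Proof. by rewrite map_inj_uniq ?iota_uniq // => i j; lia. Qed.

Lemma mem_zwindow B j : (j \in zwindow B) = (- B%:Z <= j < B%:Z).
Proof.
apply/mapP/idP => [[k]|h]; first by rewrite mem_iota; lia.
by exists `|(j + B%:Z)%R|%N; rewrite ?mem_iota; lia.
Qed.

Lemma zsum_window (B : nat) F :
  (forall j, (j < - B%:Z) || (B%:Z <= j) -> F j = 0) ->
  zsum F = \sum_(j <- zwindow B) F j.
Proof.
move=> h; apply: zsum_seq (zwindow_uniq B) _ => j.
by rewrite mem_zwindow => jB; apply: h; lia.
Qed.

Lemma zbounded_window F : zbounded F ->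
  exists B : nat, forall j, (j < - B%:Z) || (B%:Z <= j) -> F j = 0.
Proof.
by case=> m [M h]; exists (`|m| + `|M|)%N => j hj; apply: h; lia.
Qed.

Lemma eq_zsum F G : F =1 G -> zsum F = zsum G.
Proof. by move=> e; apply: eq_fsbigr => j _; apply: e. Qed.

Lemma zsum_cond (A : set int) F :
  \sum_(j \in A) F j = zsum (fun j => if j \in A then F j else 0).
Proof. by rewrite fsbig_mkcond. Qed.

Lemma zsumD F G : zbounded F -> zbounded G ->
  zsum (fun j => F j + G j) = zsum F + zsum G.
Proof.
case/zbounded_window=> B hF /zbounded_window[C hG].
by rewrite !(@zsum_window (B + C)) ?big_split // => j hj;
  rewrite ?hF ?hG ?addr0 //; lia.
Qed.

Lemma zbounded0 : zbounded (fun=> 0).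
Proof. by exists 0, 0. Qed.

Lemma zsum0 : zsum (fun=> 0) = 0.
Proof. by rewrite /zsum fsbig1. Qed.

Lemma zsum_single j0 F : (forall j, j != j0 -> F j = 0) -> zsum F = F j0.
Proof.
move=> h; rewrite (@zsum_seq [:: j0]) ?big_seq1 // => j.
by rewrite inE; apply: h.
Qed.

Lemma zsum_reflect (c : int) F : zsum F = zsum (fun j => F (c - j)).
Proof.
apply: reindex_fsbigT; exists (fun j => c - j) => j; lia.
Qed.

Lemma zsum_shift (c : int) F : zsum F = zsum (fun j => F (j + c)).
Proof.
apply: reindex_fsbigT; exists (fun j => j - c) => j; lia.
Qed.

Lemma zsum_exchange (F : int -> int -> V) (B : int) :
  (forall i j, [|| i < - B, B <= i, j < - B | B <= j] -> F i j = 0) ->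
  zsum (fun i => zsum (fun j => F i j)) = zsum (fun j => zsum (fun i => F i j)).
Proof.
move=> h.
have hw (G : int -> V) : (forall j, (j < - B) || (B <= j) -> G j = 0) ->
    zsum G = \sum_(j <- zwindow `|B|) G j.
  by move=> hG; apply: zsum_window => j hj; apply: hG; lia.
have e1 i : zsum (fun j => F i j) = \sum_(j <- zwindow `|B|) F i j.
  by apply: hw => j hj; apply: h; lia.
have e2 j : zsum (fun i => F i j) = \sum_(i <- zwindow `|B|) F i j.
  by apply: hw => i hi; apply: h; lia.
rewrite (eq_zsum e1) (eq_zsum e2) !hw.
- exact: exchange_big.
- by move=> i hi; apply: big1 => j _; apply: h; lia.
- by move=> i hi; apply: big1 => j _; apply: h; lia.
Qed.

(** The normally ordered products of a, b and of b, a cut the integers at 0 and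
    at n; this counts, with sign, the modes between the two cuts. *)
Lemma zsum_signed_interval (n : int) (c : V) :
  zsum (fun j => if (0 <= j) && (j < n) then - c
                 else if (n <= j) && (j < 0) then c else 0) = - (c *~ n).
Proof.
case: n => n.
  rewrite (@zsum_seq [seq i%:Z | i <- iota 0 n]).
  - rewrite big_map; transitivity (\sum_(i <- iota 0 n) - c).
      by apply: eq_big_seq => i; rewrite mem_iota => hi; case: ifP => //; lia.
    rewrite big_const_seq count_predT size_iota iter_addr_0 -pmulrn.
    by rewrite mulNrn.
  - by rewrite map_inj_uniq ?iota_uniq // => i j [].
  - move=> j hj; case: ifP => [hj1|_]; last by case: ifP => //; lia.
    case/mapP: hj; exists `|j|%N; rewrite ?mem_iota; lia.
rewrite NegzE (@zsum_seq [seq - i.+1%:Z | i <- iota 0 n.+1]).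
- rewrite big_map; transitivity (\sum_(i <- iota 0 n.+1) c).
    apply: eq_big_seq => i; rewrite mem_iota => hi.
    by rewrite ifT //; lia.
  rewrite big_const_seq count_predT size_iota iter_addr_0.
  by rewrite mulrNz opprK -pmulrn.
- by rewrite map_inj_uniq ?iota_uniq // => i j /oppr_inj[].
- move=> j hj; case: ifP => [|_]; first lia.
  case: ifP => // hj1; case/mapP: hj; exists `|j|.-1%N; rewrite ?mem_iota; lia.
Qed.

End Zmod.

Lemma zsum_lin {K : fieldType} {V : lmodType K} (f : V -> V) F : linear f ->
  zbounded F -> f (zsum F) = zsum (fun j => f (F j)).
Proof.
move=> lf /zbounded_window[B hF]; rewrite !(@zsum_window _ B) ?lin_sum //.
by move=> j hj; rewrite hF // lin0.
Qed.

Lemma zbounded_lin {K : fieldType} {V : lmodType K} (f : V -> V) F : linear f ->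
  zbounded F -> zbounded (fun j => f (F j)).
Proof. by move=> lf [m [M h]]; exists m, M => j /h ->; rewrite lin0. Qed.

End IntSum.

Arguments zsum_lin {K V f F}.

(** * Fields and normally ordered products *)
Section FieldCalculus.
Context {K : fieldType} {V : lmodType K}.
Implicit Types (a b c : series V) (x : V) (n j k l : int) (s p : bool).

(** The truncation condition is what makes all products of fields finite on
    each vector. *)
Definition field a : Prop :=
  (forall n, linear (a n)) /\ (forall x, exists M : int, forall n, M <= n -> a n x = 0).

Lemma field_lin a n : field a -> linear (a n). Proof. by case. Qed.

Lemma field0 a n : field a -> a n 0 = 0.
Proof. by move=> fa; apply: lin0; apply: field_lin. Qed.

Definition scommute s a b := forall j k x,
  a j (b k x) = (-1) ^+ s *: b k (a j x).

Lemma scommute_even a b : (forall j k x, a j (b k x) = b k (a j x)) ->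
  scommute false a b.
Proof. by move=> ab j k x; rewrite ab expr0 scale1r. Qed.

Lemma scommuteC s a b : scommute s a b -> scommute s b a.
Proof.
move=> h j k x; rewrite h scalerA -exprD addnn -signr_odd odd_double.
by rewrite scale1r.
Qed.

(** The product of the modes a_(j) and b_(k) in the order in which it occurs in
    :a(z)b(z):, with sign (-1)^s when the two modes are exchanged. *)
Definition npair s a b j k x : V :=
  if j < 0 then a j (b k x) else (-1) ^+ s *: b k (a j x).

Lemma npair_lin s a b j k : field a -> field b -> linear (npair s a b j k).
Proof.
move=> fa fb; rewrite /npair; case: (j < 0).
  by apply: lin_comp; apply: field_lin.
by apply: (lin_comp (@lin_scale _ _ _)); apply: lin_comp; apply: field_lin.
Qed.

Lemma field_uniform b (y : int -> V) (M : int) : field b ->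
  exists L : int, forall j k, 0 <= j < M -> L <= k -> b k (y j) = 0.
Proof.
move=> [_ tb]; suff [L hL] : exists L : int, forall (i : nat) k,
    (i < `|M|)%N -> L <= k -> b k (y i%:Z) = 0.
  by exists L => -[i|i] k hi hk //; apply: hL; lia.
elim: `|M|%N => [|m [L hL]]; first by exists 0.
have [L' hL'] := tb (y m%:Z); exists (Num.max L L') => i k him hk.
move: him; rewrite ltnS leq_eqVlt => /orP[/eqP->|him].
  by apply: hL'; lia.
by apply: hL => //; lia.
Qed.

(** Once b_(k) a_(j) has to be considered, j ranges over 0 <= j < Ma with
    a_(j) x = 0 for j >= Ma, so that only finitely many vectors a_(j) x have to
    be killed by b_(k). *)
Lemma npair_bound s a b x : field a -> field b ->
  exists M : int, forall j k, (M <= j) || (M <= k) -> npair s a b j k x = 0.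
Proof.
move=> fa fb; have [Ma ha] := fa.2 x; have [Mb hb] := fb.2 x.
have [L hL] := field_uniform (fun j => a j x) Ma fb.
exists (Num.max 0 (Num.max Ma (Num.max Mb L))) => j k hjk; rewrite /npair.
case: ifP => hj; first by rewrite hb ?(field0 _ fa) //; lia.
have [hM|hM] := lerP Ma j; first by rewrite ha // (field0 _ fb) scaler0.
by rewrite hL ?scaler0 //; lia.
Qed.

Lemma zbounded_npair s a b n x : field a -> field b ->
  zbounded (fun j => npair s a b j (n - 1 - j) x).
Proof.
move=> fa fb; have [M hM] := npair_bound s x fa fb.
by exists (n - M), M => j hj; apply: hM; lia.
Qed.

Lemma nopE pa pb a b n x : field a -> field b ->
  nop pa pb a b n x = zsum (fun j => npair (pa && pb) a b j (n - 1 - j) x).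
Proof.
move=> fa fb; have [m [M hM]] := zbounded_npair (pa && pb) n x fa fb.
have bp P : zbounded (fun j => if P j then npair (pa && pb) a b j (n - 1 - j) x else 0).
  by exists m, M => j hj; case: ifP => // _; apply: hM.
have := bp (fun j => j < 0); have := bp (fun j => ~~ (j < 0)); move=> b2 b1.
rewrite /nop !zsum_cond.
transitivity (zsum (fun j => if j < 0 then npair (pa && pb) a b j (n - 1 - j) x else 0)
  + zsum (fun j => if ~~ (j < 0) then npair (pa && pb) a b j (n - 1 - j) x else 0)).
  congr (_ + _); first apply: eq_zsum => j.
    have -> : (j \in [set j : int | j <= -1]) = (j < 0).
      by apply/idP/idP; rewrite inE /=; lia.
    by rewrite /npair; case: (j < 0).
  rewrite zsum_lin; first apply: eq_zsum => j.
  - have -> : (j \in [set j : int | 0 <= j]) = ~~ (j < 0).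
      by apply/idP/idP; rewrite inE /=; lia.
    by rewrite /npair; case: (j < 0); rewrite ?scaler0.
  - exact: lin_scale.
  - have [M2 hM2] := npair_bound false x fa fb.
    exists (n - M2), M2 => j hj.
    have -> : (j \in [set j : int | 0 <= j]) = ~~ (j < 0).
      by apply/idP/idP; rewrite inE /=; lia.
    case: ifP => // hj2; have /hM2 : (M2 <= j) || (M2 <= n - 1 - j) by lia.
    by rewrite /npair (negbTE hj2) expr0 scale1r.
rewrite -zsumD //; apply: eq_zsum => j.
by case: (j < 0); rewrite /= ?addr0 ?add0r.
Qed.

(** A term vanishes as soon as one of its indices is large.  As the two indices
    add up to n - 1, this leaves finitely many terms, and none for large n. *)
Lemma field_zsum (T : int -> int -> V -> V) :
  (forall j k, linear (T j k)) ->
  (forall x, exists M : int, forall j k, (M <= j) || (M <= k) -> T j k x = 0) ->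
  field (fun n x => zsum (fun j => T j (n - 1 - j) x)).
Proof.
move=> lT bT; have zb n x : zbounded (fun j => T j (n - 1 - j) x).
  by have [M hM] := bT x; exists (n - M), M => j hj; apply: hM; lia.
split=> [n c x y|x].
  rewrite (zsum_lin (@lin_scale _ _ c) (zb n x)) -zsumD //.
    by apply: eq_zsum => j; rewrite lT.
  by apply: zbounded_lin => //; apply: lin_scale.
have [M hM] := bT x; exists (2 * M) => n hn.
by rewrite -[RHS]zsum0; apply: eq_zsum => j; apply: hM; lia.
Qed.

Lemma eq_field a b : (forall n x, a n x = b n x) -> field a -> field b.
Proof.
move=> ab; suff -> : b = a by [].
by apply: funext => n; apply: funext => x.
Qed.

Lemma field_nop pa pb a b : field a -> field b -> field (nop pa pb a b).
Proof.
move=> fa fb; apply: eq_field (fun n x => esym (nopE pa pb n x fa fb)) _.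
apply: field_zsum => [j k|x]; first exact: npair_lin.
exact: npair_bound.
Qed.

Lemma smul_nop pa pb a b : field a -> field b ->
  scommute (pa && pb) a b -> smul a b = nop pa pb a b.
Proof.
move=> fa fb ab; apply: funext => n; apply: funext => x.
rewrite (nopE _ _ _ _ fa fb); apply: eq_zsum => j; rewrite /npair.
by case: ifP => // _; rewrite ab.
Qed.

Lemma smulE a b n x : smul a b n x = zsum (fun j => a j (b (n - 1 - j) x)).
Proof. by []. Qed.

Lemma zbounded_smul s a b n x : field a -> field b -> scommute s a b ->
  zbounded (fun j => a j (b (n - 1 - j) x)).
Proof.
move=> fa fb ab; have [m [M hM]] := zbounded_npair s n x fa fb.
by exists m, M => j /hM; rewrite /npair; case: ifP => // _ <-; rewrite ab.
Qed.

Lemma field_smul s a b : field a -> field b -> scommute s a b -> field (smul a b).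
Proof.
by case: s => fa fb ab;
  [rewrite (@smul_nop true true) | rewrite (@smul_nop false false)] => //;
  apply: field_nop.
Qed.

Lemma field_sderiv a : field a -> field (sderiv a).
Proof.
move=> fa; split=> [n|x].
  by apply: (lin_comp (@lin_scale _ _ _)); apply: field_lin.
have [M hM] := fa.2 x; exists (M + 1) => n hn.
by rewrite /sderiv hM ?scaler0 //; lia.
Qed.

Lemma field_sscale (t : K) a : field a -> field (sscale t a).
Proof.
move=> fa; split=> [n|x].
  by apply: (lin_comp (@lin_scale _ _ _)); apply: field_lin.
by have [M hM] := fa.2 x; exists M => n hn; rewrite /sscale hM ?scaler0.
Qed.

Lemma field_sadd a b : field a -> field b -> field (sadd a b).
Proof.
move=> fa fb; split=> [n|x]; first by apply: lin_add; apply: field_lin.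
have [M hM] := fa.2 x; have [L hL] := fb.2 x.
by exists (Num.max M L) => n hn; rewrite /sadd hM ?hL ?addr0 //; lia.
Qed.

Lemma field_ssum (I : finType) (a : I -> series V) :
  (forall i, field (a i)) -> field (ssum a).
Proof.
move=> fa; split=> [n|x].
  by apply: lin_sum_fun => i; apply: field_lin.
have /choice[M hM] i := (fa i).2 x.
exists (\sum_i `|M i|) => n hn; apply: big1 => i _; apply: hM.
have : `|M i| <= \sum_i `|M i|.
  by rewrite (bigD1 i) //= lerDl sumr_ge0.
by lia.
Qed.

Lemma smulC a b : scommute false a b -> smul a b = smul b a.
Proof.
move=> ab; apply: funext => n; apply: funext => x.
rewrite !smulE (zsum_reflect (n - 1)); apply: eq_zsum => j.
by rewrite ab expr0 scale1r; congr (b _ (a _ x)); lia.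
Qed.

Lemma scommute_nop pa pb a b c : field a -> field b -> field c ->
  scommute false a c -> scommute false b c -> scommute false (nop pa pb a b) c.
Proof.
move=> fa fb fc ac bc j k x; rewrite expr0 scale1r !nopE //.
rewrite (zsum_lin (field_lin k fc) (zbounded_npair _ _ _ fa fb)).
apply: eq_zsum => i; rewrite /npair; case: (i < 0).
  by rewrite bc expr0 scale1r ac expr0 scale1r.
by rewrite (linZ _ (field_lin k fc)) ac expr0 scale1r bc expr0 scale1r.
Qed.

(** Both sides are the sum of N(a_(j) b_(k)) c_(l) over j + k + l = n - 2, where
    N is the normal order: since c commutes with a, its modes can be moved to
    the right of a_(j) also in the terms where a_(j) acts first. *)
Lemma nop_smul pa pb a b c : field a -> field b -> field c ->
  scommute false a c -> scommute false b c ->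
  nop pa pb a (smul b c) = smul (nop pa pb a b) c.
Proof.
move=> fa fb fc ac bc; apply: funext => n; apply: funext => x.
have fbc := field_smul fb fc bc; set s := pa && pb.
have npc j k l y : npair s a b j k (c l y) = c l (npair s a b j k y).
  rewrite /npair; case: ifP => _; rewrite ?(linZ _ (field_lin l fc)).
    by rewrite bc expr0 scale1r ac expr0 scale1r.
  by rewrite ac expr0 scale1r bc expr0 scale1r.
rewrite nopE // smulE -/s.
transitivity (zsum (fun j => zsum (fun k => npair s a b j k (c (n - 2 - j - k) x)))).
  apply: eq_zsum => j; rewrite /npair smulE; case: ifP => hj.
    rewrite (zsum_lin (field_lin j fa) (zbounded_smul _ _ fb fc bc)).
    by apply: eq_zsum => k; congr (a j (b k (c _ x))); lia.
  rewrite smulE (zsum_lin (@lin_scale _ _ _) (zbounded_smul _ _ fb fc bc)).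
  apply: eq_zsum => k; rewrite ac expr0 scale1r.
  by congr (_ *: b k (c _ (a j x))); lia.
(* the inner index becomes m = j + k + 1, the mode of the product of a and b *)
transitivity (zsum (fun j => zsum (fun m =>
    npair s a b j (m - 1 - j) (c (n - 1 - m) x)))).
  apply: eq_zsum => j; rewrite (zsum_shift (- 1 - j)); apply: eq_zsum => m.
  by congr (npair s a b j _ (c _ x)); lia.
have [M hM] := npair_bound s x fa fb; have [L hL] := fc.2 x.
(* j, m - 1 - j and n - 1 - m are bounded above, hence so are |j| and |m| *)
rewrite (@zsum_exchange _ _ (3 * `|M| + 3 * `|L| + 3 * `|n| + 3)).
  by apply: eq_zsum => m; rewrite nopE.
move=> j m hjm; have [hc|hc] := lerP L (n - 1 - m).
  by rewrite hL // lin0 //; apply: npair_lin.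
rewrite npc; have [hab|hab] := boolP ((M <= j) || (M <= m - 1 - j)).
  by rewrite hM // field0.
lia.
Qed.

(** In the mode n, a_(j) is on the left of b_(n-1-j) for j < 0 in :a b: and for
    j < n in :b a:.  Between the two cuts the products occur in both orders, and
    each of them contributes the anticommutator C_(n-1). *)
Lemma nop_skew a b (C : int -> V -> V) n x : field a -> field b ->
  (forall j k y, a j (b k y) + b k (a j y) = C (j + k) y) ->
  nop true true a b n x = - nop true true b a n x + sderiv C n x.
Proof.
move=> fa fb ab; rewrite !nopE //=.
apply/eqP; rewrite -subr_eq0 opprD opprK addrA subr_eq0; apply/eqP.
rewrite [X in _ + X](zsum_reflect (n - 1)) -zsumD; last 2 first.
- exact: zbounded_npair.
- have [M hM] := npair_bound true x fb fa.
  by exists (n - M), M => j hj; apply: hM; lia.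
rewrite /sderiv scaleNr scaler_int -zsum_signed_interval; apply: eq_zsum => j.
have -> : n - 1 - (n - 1 - j) = j by lia.
have -> : C (n - 1) x = a j (b (n - 1 - j) x) + b (n - 1 - j) (a j x).
  by rewrite ab; congr (C _ x); lia.
rewrite /npair expr1 !scaleN1r.
have -> : (n - 1 - j < 0) = (n <= j) by lia.
have -> : (j < n) = ~~ (n <= j) by lia.
have -> : (j < 0) = ~~ (0 <= j) by lia.
case: (0 <= j); case: (n <= j) => //=; rewrite ?addNr ?subrr //.
by rewrite opprD addrC.
Qed.

(** The supercommutator of the odd operator D with a(z), of parity p, is a'(z). *)
Definition sder (D : V -> V) p a a' := forall n x,
  D (a n x) = a' n x + (-1) ^+ p *: a n (D x).

(** Leibniz rule.  It holds for each product of modes; the truncation of a' and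
    b' makes the sums of the resulting terms finite separately. *)
Lemma sder_nop D pa pb a b a' b' : linear D ->
  field a -> field b -> field a' -> field b' ->
  sder D pa a a' -> sder D pb b b' ->
  sder D (pa (+) pb) (nop pa pb a b)
    (sadd (nop (~~ pa) pb a' b) (sscale ((-1) ^+ pa) (nop pa (~~ pb) a b'))).
Proof.
move=> lD fa fb fa' fb' da db n x; rewrite /sadd /sscale !nopE //.
have zb := zbounded_npair; have zl := zbounded_lin.
rewrite (zsum_lin lD) ?(zsum_lin (@lin_scale _ _ _)); try exact: zb.
rewrite -!zsumD; try by [apply: zb | apply: zl; [exact: lin_scale | exact: zb]].
  apply: eq_zsum => j; rewrite /npair; case: ifP => _.
    rewrite da db (linD (field_lin j fa)) (linZ _ (field_lin j fa)) scalerDr addrA.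
    by rewrite scalerA -signr_addb.
  rewrite (linZ _ lD) db da (linD (field_lin _ fb)) (linZ _ (field_lin _ fb)).
  rewrite !scalerDr !scalerA -!signr_addb addrA.
  by rewrite [X in X + _ = _]addrC; case: (pa); case: (pb).
have [M hM] := npair_bound (~~ pa && pb) x fa' fb.
have [L hL] := npair_bound (pa && ~~ pb) x fa fb'.
exists (n - Num.max M L), (Num.max M L) => j hj.
by rewrite hM ?hL ?scaler0 ?addr0 //; lia.
Qed.

Lemma sder_ssum D p (I : finType) (a a' : I -> series V) : linear D ->
  (forall i, sder D p (a i) (a' i)) -> sder D p (ssum a) (ssum a').
Proof.
move=> lD da n x; rewrite /ssum (lin_sum _ _ _ lD) scaler_sumr -big_split /=.
by apply: eq_bigr => i _; apply: da.
Qed.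

Lemma ssum_sadd (I : finType) (a b : I -> series V) :
  ssum (fun i => sadd (a i) (b i)) = sadd (ssum a) (ssum b).
Proof. by apply: funext => n; apply: funext => x; rewrite /ssum big_split. Qed.

Lemma zsum_sum (I : finType) (F : I -> int -> V) : (forall i, zbounded (F i)) ->
  zsum (fun j => \sum_i F i j) = \sum_i zsum (F i).
Proof.
move=> zF; suff [//] : zsum (fun j => \sum_i F i j) = \sum_i zsum (F i) /\
  zbounded (fun j => \sum_i F i j).
elim: index_enum => [|i r [IH zr]].
  by under eq_fun do rewrite big_nil; rewrite big_nil zsum0; split=> //; exists 0, 0.
under eq_fun do rewrite big_cons; rewrite big_cons zsumD // IH; split=> //.
have [m [M h]] := zF i; have [m' [M' h']] := zr.
exists (Num.min m m'), (Num.max M M') => j hj; rewrite h ?h' ?addr0 //; lia.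
Qed.

Lemma nop_ssuml pa pb (I : finType) (a : I -> series V) b :
  (forall i, field (a i)) -> field b ->
  nop pa pb (ssum a) b = ssum (fun i => nop pa pb (a i) b).
Proof.
move=> fa fb; apply: funext => n; apply: funext => x.
rewrite /ssum (nopE _ _ _ _ (field_ssum fa) fb).
under eq_bigr do rewrite nopE //.
rewrite -zsum_sum; last by move=> i; apply: zbounded_npair.
apply: eq_zsum => j; rewrite /npair; case: (j < 0) => //.
by rewrite (lin_sum _ _ _ (field_lin _ fb)) scaler_sumr.
Qed.

Lemma nop_ssumr pa pb (I : finType) a (b : I -> series V) :
  field a -> (forall i, field (b i)) ->
  nop pa pb a (ssum b) = ssum (fun i => nop pa pb a (b i)).
Proof.
move=> fa fb; apply: funext => n; apply: funext => x.
rewrite /ssum (nopE _ _ _ _ fa (field_ssum fb)).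
under eq_bigr do rewrite nopE //.
rewrite -zsum_sum; last by move=> i; apply: zbounded_npair.
apply: eq_zsum => j; rewrite /npair; case: (j < 0).
  by rewrite (lin_sum _ _ _ (field_lin _ fa)).
by rewrite scaler_sumr.
Qed.

Lemma nop_sscalel pa pb (t : K) a b : field a -> field b ->
  nop pa pb (sscale t a) b = sscale t (nop pa pb a b).
Proof.
move=> fa fb; apply: funext => n; apply: funext => x.
rewrite /sscale (nopE _ _ _ _ (field_sscale t fa) fb) nopE //.
rewrite (zsum_lin (@lin_scale _ _ _) (zbounded_npair _ _ _ fa fb)).
apply: eq_zsum => j; rewrite /npair; case: (j < 0) => //.
by rewrite (linZ _ (field_lin _ fb)) !scalerA mulrC.
Qed.

Lemma nop_sscaler pa pb (t : K) a b : field a -> field b ->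
  nop pa pb a (sscale t b) = sscale t (nop pa pb a b).
Proof.
move=> fa fb; apply: funext => n; apply: funext => x.
rewrite /sscale (nopE _ _ _ _ fa (field_sscale t fb)) nopE //.
rewrite (zsum_lin (@lin_scale _ _ _) (zbounded_npair _ _ _ fa fb)).
apply: eq_zsum => j; rewrite /npair; case: (j < 0).
  by rewrite (linZ _ (field_lin _ fa)).
by rewrite !scalerA mulrC.
Qed.

End FieldCalculus.

(** * The differential and its exact fields *)
Section Differential.
Context {K : numFieldType} {V : lmodType K} {I : finType}.
Context (u v phi psi : I -> series V).
Implicit Types (x y : V) (p q : I) (j k n : int).

Context (field_u : forall p, field (u p)) (field_v : forall p, field (v p)).
Context (field_phi : forall p, field (phi p)) (field_psi : forall p, field (psi p)).
Context (u_phi : forall p j q k x, u p j (phi q k x) = phi q k (u p j x)).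
Context (u_psi : forall p j q k x, u p j (psi q k x) = psi q k (u p j x)).
Context (v_phi : forall p j q k x, v p j (phi q k x) = phi q k (v p j x)).
Context (v_psi : forall p j q k x, v p j (psi q k x) = psi q k (v p j x)).
Context (v_v : forall p j q k x, v p j (v q k x) = v q k (v p j x)).
Context (phi_phi : forall p j q k x, phi p j (phi q k x) = - phi q k (phi p j x)).
Context (v_u : forall p j q k x, v p j (u q k x) =
  u q k (v p j x) + (if (p == q) && (j + k == 0) then j%:~R *: x else 0)).
Context (phi_psi : forall p j q k x, phi p j (psi q k x) =
  - psi q k (phi p j x) + (if (p == q) && (j + k == -1) then x else 0)).

Definition diff : V -> V := ssum (fun p => smul (v p) (phi p)) 0.

Lemma diff_lin : linear diff.
Proof.
apply: field_lin; apply: field_ssum => p.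
exact: field_smul (field_v p) (field_phi p) (scommute_even (fun j k x => @v_phi p j p k x)).
Qed.

Lemma diff_bounded p x : zbounded (fun j => v p j (phi p (0 - 1 - j) x)).
Proof.
exact: zbounded_smul (field_v p) (field_phi p)
  (scommute_even (fun j k x => @v_phi p j p k x)).
Qed.

(** The supercommutator with T can be computed mode by mode. *)
Lemma diff_ad (T : V -> V) (s : bool) (e : I -> int -> V) x : linear T ->
  (forall p, zbounded (e p)) ->
  (forall p j, v p j (phi p (0 - 1 - j) (T x)) =
     e p j + (-1) ^+ s *: T (v p j (phi p (0 - 1 - j) x))) ->
  diff (T x) = \sum_p zsum (e p) + (-1) ^+ s *: T (diff x).
Proof.
move=> lT be hT; rewrite /diff /ssum (lin_sum _ _ _ lT) scaler_sumr -big_split /=.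
apply: eq_bigr => p _; rewrite !smulE (eq_zsum (hT p)).
rewrite (zsum_lin lT (diff_bounded p x)) (zsum_lin (@lin_scale _ _ _)).
  rewrite -zsumD //; apply: zbounded_lin; first exact: lin_scale.
  exact: zbounded_lin lT (diff_bounded p x).
exact: zbounded_lin lT (diff_bounded p x).
Qed.

(** Among the modes v_(j) phi_(-1-j) only j = - n meets u_(n), with commutator
    - n, which yields the mode - n phi_(n-1) of the derivative. *)
Lemma sder_u q : sder diff false (u q) (sderiv (phi q)).
Proof.
move=> n x.
have sE (j : int) : j = - n -> j%:~R *: phi q (0 - 1 - j) x = sderiv (phi q) n x.
  by move=> ->; rewrite /sderiv mulrNz; congr (_ *: phi q _ x); lia.
rewrite (@diff_ad _ false (fun p j => if (p == q) && (j + n == 0)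
   then j%:~R *: phi p (0 - 1 - j) x else 0)).
- congr (_ + _); rewrite (bigD1 q) //= big1 ?addr0; last first.
    by move=> p pq; rewrite -[RHS]zsum0; apply: eq_zsum => j; rewrite (negbTE pq).
  rewrite (zsum_single (j0 := - n)); first by rewrite eqxx addNr eqxx sE.
  by move=> j jn; rewrite eqxx ifF //; apply/eqP; lia.
- exact: field_lin.
- by move=> p; exists (- n), (- n + 1) => j hj; rewrite ifF //; lia.
- by move=> p j; rewrite -u_phi v_u expr0 scale1r addrC.
Qed.

Lemma sder_v q : sder diff false (v q) (fun _ => fun=> 0).
Proof.
move=> n x; rewrite (@diff_ad _ false (fun=> fun=> 0)).
- by rewrite big1 // => p _; rewrite zsum0.
- exact: field_lin.
- by move=> p; apply: zbounded0.
- by move=> p j; rewrite -v_phi v_v expr0 scale1r [RHS]add0r.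
Qed.

Lemma sder_phi q : sder diff true (phi q) (fun _ => fun=> 0).
Proof.
move=> n x; rewrite (@diff_ad _ true (fun=> fun=> 0)).
- by rewrite big1 // => p _; rewrite zsum0.
- exact: field_lin.
- by move=> p; apply: zbounded0.
- by move=> p j; rewrite phi_phi (linN (field_lin _ (field_v p))) v_phi expr1 scaleN1r [RHS]add0r.
Qed.

Lemma sder_psi q : sder diff true (psi q) (v q).
Proof.
move=> n x.
rewrite (@diff_ad _ true (fun p j => if (p == q) && (j == n) then v p j x else 0)).
- congr (_ + _); rewrite (bigD1 q) //= big1 ?addr0; last first.
    by move=> p pq; rewrite -[RHS]zsum0; apply: eq_zsum => j; rewrite (negbTE pq).
  rewrite (zsum_single (j0 := n)); first by rewrite !eqxx.
  by move=> j jn; rewrite eqxx (negbTE jn).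
- exact: field_lin.
- by move=> p; exists n, (n + 1) => j hj; rewrite ifF //; lia.
- move=> p j; have lv := field_lin j (field_v p).
  rewrite phi_psi (linD lv) (linN lv) v_psi addrC expr1 scaleN1r; congr (_ + _).
  have -> : (0 - 1 - j + n == -1) = (j == n) by lia.
  by case: ifP => _ //; rewrite (lin0 lv).
Qed.

(** Moving the outer differential through v_(j) phi_(-1-j), with which it
    anticommutes, gives D D = - D D. *)
Lemma diff_square x : diff (diff x) = 0.
Proof.
suff h : diff (diff x) = - diff (diff x).
  have : (2 : K) *: diff (diff x) = 0 by rewrite scaler_nat mulr2n {1}h addNr.
  by move/eqP; rewrite scaler_eq0 pnatr_eq0 => /eqP.
have diffE y : diff y = \sum_p zsum (fun j => v p j (phi p (0 - 1 - j) y)) by [].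
rewrite [X in _ = - X]diffE -sumrN (diffE x) (lin_sum _ _ _ diff_lin).
apply: eq_bigr => p _.
rewrite (zsum_lin diff_lin (diff_bounded p x)).
rewrite -[RHS]scaleN1r (zsum_lin (@lin_scale _ _ _) (diff_bounded p _)).
apply: eq_zsum => j; rewrite (sder_v p) (sder_phi p) !add0r expr0 scale1r expr1.
by rewrite (linZ _ (field_lin _ (field_v p))).
Qed.

Section VertexField.
Context (c : I -> K) (Y : series V) (field_Y : field Y).
Context (u_Y : forall p j k x, u p j (Y k x) = Y k (u p j x)).
Context (phi_Y : forall p j k x, phi p j (Y k x) = Y k (phi p j x)).
Context (psi_Y : forall p j k x, psi p j (Y k x) = Y k (psi p j x)).
Context (v_Y : forall p j k x, v p j (Y k x) = Y k (v p j x) + c p *: Y (k + j) x).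

Let phiY : series V := ssum (fun p => sscale (c p) (smul (phi p) Y)).

Lemma field_smul_phi_Y p : field (smul (phi p) Y).
Proof. exact: field_smul (field_phi p) field_Y (scommute_even (@phi_Y p)). Qed.

Lemma field_phiY : field phiY.
Proof. by apply: field_ssum => p; apply: field_sscale; apply: field_smul_phi_Y. Qed.

(** The commutator of v_(j) with Y(z) multiplies Y(z) by c_p z^j; summed against
    phi_(-1-j) these factors rebuild phi(z). *)
Lemma sder_Y : sder diff false Y phiY.
Proof.
move=> n x.
have b p : zbounded (fun j => Y (n + j) (phi p (0 - 1 - j) x)).
  have [m [M h]] := zbounded_smul n x (field_phi p) field_Y (scommute_even (@phi_Y p)).
  exists (- M), (- m) => j hj; rewrite -phi_Y.
  have -> : n + j = n - 1 - (0 - 1 - j) by lia.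
  by apply: h; lia.
rewrite (@diff_ad _ false (fun p j => c p *: Y (n + j) (phi p (0 - 1 - j) x))).
- congr (_ + _); apply: eq_bigr => p _.
  rewrite -(zsum_lin (@lin_scale _ _ _) (b p)) /sscale smulE (zsum_reflect (0 - 1)).
  congr (_ *: _); apply: eq_zsum => j; rewrite -phi_Y.
  by congr (phi p _ (Y _ x)); lia.
- exact: field_lin.
- by move=> p; apply: zbounded_lin (b p); apply: lin_scale.
- by move=> p j; rewrite phi_Y v_Y addrC expr0 scale1r.
Qed.

Let E p q : series V := nop true true (phi p) (psi q).

Lemma field_E p q : field (E p q). Proof. exact: field_nop. Qed.

(** The contraction of psi and phi is a constant: it lives in C_(-1) only, where
    n - 1 = -1 makes the correction - n C_(n-1) vanish. *)
Lemma nop_psi_phi p q : nop true true (psi q) (phi p) = sscale (-1) (E p q).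
Proof.
apply: funext => n; apply: funext => x.
rewrite (@nop_skew _ _ _ _ (fun m y => if (p == q) && (m == -1) then y else 0)) //.
  rewrite /sscale scaleN1r /sderiv.
  have [->|n0] := eqVneq n 0; first by rewrite oppr0 scale0r addr0.
  by rewrite ifF ?scaler0 ?addr0 //; apply/andP => -[_ /eqP]; lia.
by move=> j k y; rewrite phi_psi addrA addrN add0r [(j + k)%R]addrC.
Qed.

Lemma smul_sscale_sum (J : finType) (t : J -> K) (a : J -> series V) :
  (forall i, field (a i)) -> (forall i j k x, a i j (Y k x) = Y k (a i j x)) ->
  smul (ssum (fun i => sscale (t i) (a i))) Y =
  ssum (fun i => sscale (t i) (smul (a i) Y)).
Proof.
move=> fa aY; rewrite (@smul_nop _ _ false false) //; last first.
- apply: scommute_even => j k x; rewrite /ssum (lin_sum _ _ _ (field_lin _ field_Y)).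
  by apply: eq_bigr => i _; rewrite /sscale aY (linZ _ (field_lin _ field_Y)).
- by apply: field_ssum => i; apply: field_sscale.
rewrite nop_ssuml //; last by move=> i; apply: field_sscale.
congr (ssum _); apply: funext => i; rewrite nop_sscalel //.
by rewrite -(@smul_nop _ _ false false) //; apply: scommute_even.
Qed.

(** Y commutes with a and with phi, so it can be factored out on the right. *)
Lemma nop_phiY a : field a -> (forall j k x, a j (Y k x) = Y k (a j x)) ->
  nop true true a phiY = ssum (fun p => sscale (c p) (smul (nop true true a (phi p)) Y)).
Proof.
move=> fa aY; rewrite nop_ssumr //; last first.
  by move=> p; apply: field_sscale; apply: field_smul_phi_Y.
congr (ssum _); apply: funext => p; rewrite nop_sscaler //; last exact: field_smul_phi_Y.
by rewrite nop_smul //; apply: scommute_even.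
Qed.

Lemma E_Y p q j k x : E p q j (Y k x) = Y k (E p q j x).
Proof.
have h : scommute false (E p q) Y.
  by apply: scommute_nop => //; apply: scommute_even.
by rewrite h expr0 scale1r.
Qed.

Lemma smul_sscale (t : K) (a : series V) : field a ->
  (forall j k x, a j (Y k x) = Y k (a j x)) ->
  smul (sscale t a) Y = sscale t (smul a Y).
Proof.
move=> fa aY; apply: funext => n; apply: funext => x.
rewrite /sscale smulE; symmetry; apply: zsum_lin; first exact: lin_scale.
exact: zbounded_smul fa field_Y (scommute_even aY).
Qed.

Lemma sadd_signK (a b : series V) n x y :
  sadd a b n x + (-1) ^+ true *: y + y = sadd a b n x.
Proof. by rewrite expr1 scaleN1r addrNK. Qed.

(** The Leibniz rule gives :v Y: - :psi (phi Y):, and the second term is the sum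
    of the products - :psi phi: Y = E Y. *)
Lemma field_d_exact q n x :
  sadd (nop false false (v q) Y)
       (ssum (fun p => sscale (c p) (smul (E p q) Y))) n x =
  diff (nop true false (psi q) Y n x) + nop true false (psi q) Y n (diff x).
Proof.
rewrite (sder_nop diff_lin (field_psi q) field_Y (field_v q) field_phiY
  (sder_psi q) sder_Y) sadd_signK.
congr (sadd _ _ n x); rewrite nop_phiY //; apply: funext => m; apply: funext => y.
rewrite /sscale /ssum /= expr1 scaler_sumr; apply: eq_bigr => p _.
rewrite nop_psi_phi smul_sscale; [|exact: field_E|exact: E_Y].
by rewrite /sscale !scaleN1r scalerN opprK.
Qed.

(** The sum of these fields is the primitive of omega: its supercommutator with
    the differential is omega. *)
Let tau p : series V := nop false true (u p) (psi p).

Lemma field_tau p : field (tau p). Proof. exact: field_nop. Qed.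

(** In this form u, which commutes with phi, can be taken out of :phi tau: by
    [nop_smul]. *)
Lemma tau_smul p : tau p = smul (psi p) (u p).
Proof.
rewrite /tau -smul_nop //; last exact: scommute_even.
by apply: smulC; apply: scommute_even.
Qed.

Lemma tau_Y p j k x : tau p j (Y k x) = Y k (tau p j x).
Proof.
have h : scommute false (tau p) Y.
  by apply: scommute_nop => //; apply: scommute_even.
by rewrite h expr0 scale1r.
Qed.

Let omega : series V := sadd (ssum (fun p => nop false false (u p) (v p)))
  (ssum (fun p => nop true true (sderiv (phi p)) (psi p))).

Lemma sder_tau : sder diff true (ssum tau) omega.
Proof.
have -> : omega = ssum (fun p => sadd (nop true true (sderiv (phi p)) (psi p))
    (sscale 1 (nop false false (u p) (v p)))).
  apply: funext => n; apply: funext => x; rewrite ssum_sadd /omega /sadd addrC.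
  by congr (_ + _); apply: eq_bigr => p _; rewrite /sscale scale1r.
apply: (sder_ssum diff_lin) => p.
exact: (sder_nop diff_lin (field_u p) (field_psi p) (field_sderiv (field_phi p))
  (field_v p) (sder_u p) (sder_psi p)).
Qed.

(** Contracting psi with phi in u psi leaves u, so that tau_(j) and phi_(k)
    anticommute to u_(j+k); the correction of [nop_skew] is the derivative of u. *)
Lemma nop_tau_phi p q : nop true true (tau p) (phi q) =
  sadd (sscale (-1) (smul (u p) (E q p)))
       (sderiv (fun m y => if p == q then u p m y else 0)).
Proof.
have up := scommute_even (fun j k => @u_psi p j p k).
apply: funext => n; apply: funext => x.
rewrite (@nop_skew _ _ _ _ (fun m y => if p == q then u p m y else 0)) //; last 2 first.
- exact: field_tau.
- move=> j k y.
  have tE z : tau p j z = zsum (fun i => u p i (psi p (j - 1 - i) z)).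
    by rewrite /tau -smul_nop.
  rewrite !tE (zsum_lin (field_lin k (field_phi q))
    (zbounded_smul j y (field_u p) (field_psi p) up)).
  rewrite -zsumD; last 2 first.
  + exact: zbounded_smul (field_u p) (field_psi p) up.
  + apply: zbounded_lin; first exact: field_lin.
    exact: zbounded_smul (field_u p) (field_psi p) up.
  rewrite (zsum_single (j0 := j + k)).
    rewrite -u_phi -(linD (field_lin _ (field_u p))) phi_psi addrA addrN add0r.
    rewrite eq_sym; have -> : (k + (j - 1 - (j + k)) == -1) by lia.
    by rewrite andbT; case: eqP => // _; rewrite field0.
  move=> i ijk; rewrite -u_phi -(linD (field_lin _ (field_u p))) phi_psi.
  rewrite addrA addrN add0r ifF ?field0 //; apply/andP => -[_ /eqP]; lia.
rewrite /sadd; congr (_ + _); rewrite /sscale scaleN1r; congr (- _).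
rewrite tau_smul nop_smul //; last 2 first.
- by apply: scommuteC; apply: scommute_even.
- by apply: scommuteC; apply: scommute_even.
rewrite smulC //; apply: scommute_nop => //.
- by apply: scommuteC; apply: scommute_even.
- by apply: scommuteC; apply: scommute_even.
Qed.

Lemma smul_sadd (a b : series V) : field a -> field b ->
  (forall j k x, a j (Y k x) = Y k (a j x)) ->
  (forall j k x, b j (Y k x) = Y k (b j x)) ->
  smul (sadd a b) Y = sadd (smul a Y) (smul b Y).
Proof.
move=> fa fb aY bY; apply: funext => n; apply: funext => x.
rewrite /sadd !smulE -zsumD //.
  exact: zbounded_smul fa field_Y (scommute_even aY).
exact: zbounded_smul fb field_Y (scommute_even bY).
Qed.

Lemma u_E p q r j k x : u p j (E q r k x) = E q r k (u p j x).
Proof.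
have h : scommute false (E q r) (u p).
  by apply: scommute_nop => //; apply: scommuteC; apply: scommute_even.
by rewrite h expr0 scale1r.
Qed.

Let uE p q : series V := smul (u p) (E q p).

Lemma field_uE p q : field (uE p q).
Proof.
exact: field_smul (field_u p) (field_E q p) (scommute_even (@u_E p q p)).
Qed.

Lemma uE_Y p q j k x : uE p q j (Y k x) = Y k (uE p q j x).
Proof.
have e : uE p q = nop false false (u p) (E q p).
  by apply: smul_nop => //; [exact: field_E | apply: scommute_even; apply: u_E].
have h : scommute false (uE p q) Y.
  rewrite e; apply: scommute_nop; try exact: field_E; try by [].
    exact: scommute_even.
  by apply: scommute_even; apply: E_Y.
by rewrite h expr0 scale1r.
Qed.

Lemma sderiv_u_Y p j k x : sderiv (u p) j (Y k x) = Y k (sderiv (u p) j x).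
Proof. by rewrite /sderiv u_Y (linZ _ (field_lin _ field_Y)). Qed.

Lemma smul_nop_tau_phi q : smul (nop true true (ssum tau) (phi q)) Y =
  sadd (sscale (-1) (ssum (fun p => smul (uE p q) Y))) (smul (sderiv (u q)) Y).
Proof.
have fS : field (ssum (fun p => sscale (-1) (uE p q))).
  by apply: field_ssum => p; apply: field_sscale; apply: field_uE.
have -> : nop true true (ssum tau) (phi q) =
    sadd (ssum (fun p => sscale (-1) (uE p q))) (sderiv (u q)).
  rewrite nop_ssuml //; last exact: field_tau.
  apply: funext => n; apply: funext => x.
  rewrite /ssum; under eq_bigr do rewrite nop_tau_phi.
  rewrite /sadd big_split /=; congr (_ + _).
  rewrite (bigD1 q) //= big1 ?addr0; first by rewrite /sderiv eqxx.
  by move=> p pq; rewrite /sderiv (negbTE pq) scaler0.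
rewrite smul_sadd //; last 3 first.
- exact: field_sderiv.
- move=> j k x; rewrite /ssum (lin_sum _ _ _ (field_lin _ field_Y)).
  by apply: eq_bigr => i _; rewrite /sscale uE_Y (linZ _ (field_lin _ field_Y)).
- exact: sderiv_u_Y.
rewrite (smul_sscale_sum (fun=> -1)).
- apply: funext => n; apply: funext => x.
  by rewrite /sadd /ssum /sscale scaler_sumr.
- by move=> p; apply: field_uE.
- by move=> p; apply: uE_Y.
Qed.

Lemma field_omega : field omega.
Proof.
apply: field_sadd; apply: field_ssum => p; apply: field_nop => //.
exact: field_sderiv.
Qed.

Lemma field_d0_exact n x :
  sadd (sadd (sscale (-1) (nop false false omega Y))
    (sscale (-1) (ssum (fun p => ssum (fun q =>
       sscale (c p) (smul (smul (u q) (E p q)) Y))))))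
    (ssum (fun p => sscale (c p) (smul (sderiv (u p)) Y))) n x =
  - (diff (nop true false (ssum tau) Y n x) + nop true false (ssum tau) Y n (diff x)).
Proof.
have ft : field (ssum tau) by apply: field_ssum; apply: field_tau.
have tY j k y : ssum tau j (Y k y) = Y k (ssum tau j y).
  rewrite /ssum (lin_sum _ _ _ (field_lin _ field_Y)).
  by apply: eq_bigr => i _; apply: tau_Y.
rewrite (sder_nop diff_lin ft field_Y field_omega field_phiY sder_tau sder_Y).
rewrite sadd_signK /sadd /sscale /= expr1 !scaleN1r [RHS]opprD opprK -addrA.
congr (_ + _); rewrite (nop_phiY ft tY) /ssum -sumrN -big_split /=.
apply: eq_bigr => p _; rewrite smul_nop_tau_phi /sscale /sadd /ssum.
rewrite [RHS]scalerDr; congr (_ + _); rewrite scaleN1r scalerN; congr (- _).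
by rewrite [RHS]scaler_sumr.
Qed.

End VertexField.

End Differential.

(** * Coefficients of exponential series *)
Section Exponential.
Context {K : numFieldType} {V : lmodType K}.
Context (A : nat -> V -> V).
Implicit Types (x : V) (k m n : nat).

(** The index m of G keeps track of the power of z: with G m the vectors whose
    weight dropped by m this bounds the length of the series, and with G
    independent of m it is stability under the coefficients of A. *)
Lemma pow_coef_closed (G : nat -> V -> Prop) :
  (forall m, G m 0) -> (forall m x y, G m x -> G m y -> G m (x + y)) ->
  (forall i m x, G m x -> G (m + i.+1)%N (A i x)) ->
  forall k m n x, G m x -> G (m + n)%N (pow_coef A k n x).
Proof.
move=> G0 GD GA; elim=> [|k IH] m n x Gx /=.
  by case: eqP => [->|_]; rewrite ?addn0.
apply: (big_ind (G (m + n)%N)) => [||i _]; [exact: G0 | exact: GD |].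
have -> : (m + n = m + (n - i.+1) + i.+1)%N by have := ltn_ord i; lia.
by apply: GA; apply: IH.
Qed.

Lemma exp_coef_closed (G : nat -> V -> Prop) :
  (forall m, G m 0) -> (forall m x y, G m x -> G m y -> G m (x + y)) ->
  (forall m (t : K) x, G m x -> G m (t *: x)) ->
  (forall i m x, G m x -> G (m + i.+1)%N (A i x)) ->
  forall m n x, G m x -> G (m + n)%N (exp_coef A n x).
Proof.
move=> G0 GD GZ GA m n x Gx; apply: (big_ind (G (m + n)%N)) => [||k _]; [exact: G0 | exact: GD |].
by apply: GZ; apply: pow_coef_closed.
Qed.

Context (lA : forall i, linear (A i)).

Lemma pow_coef_lin k n : linear (pow_coef A k n).
Proof.
elim: k n => [|k IH] n /=; first by case: eqP => _ t x y; rewrite ?scaler0 ?addr0.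
by apply: lin_sum_fun => i; apply: lin_comp.
Qed.

Lemma exp_coef_lin n : linear (exp_coef A n).
Proof.
apply: lin_sum_fun => k; apply: (lin_comp (@lin_scale _ _ _)).
exact: pow_coef_lin.
Qed.

Lemma pow_coef_small k n x : (n < k)%N -> pow_coef A k n x = 0.
Proof.
elim: k n => [|k IH] n //= nk; apply: big1 => i _.
by rewrite IH ?lin0 //; have := ltn_ord i; lia.
Qed.

Context (T : V -> V) (c : K) (j : nat) (lT : linear T) (j_gt0 : (0 < j)%N).
Context (TA : forall i x,
  T (A i x) = A i (T x) + (if i.+1 == j then c *: x else 0)).

(** If [T, A(z)] = c z^j then [T, A(z)^k] = k c z^j A(z)^(k-1): the commutator
    is a scalar, hence the coefficients of A are not required to commute with
    each other. *)
Lemma pow_coef_ad k n x : T (pow_coef A k n x) = pow_coef A k n (T x) +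
  (if (j <= n)%N then (c * k%:R) *: pow_coef A k.-1 (n - j) x else 0).
Proof.
elim: k n => [|k IH] n.
  by rewrite mulr0 scale0r if_same addr0 /=; case: eqP => // _; rewrite lin0.
rewrite /= (lin_sum _ _ _ lT).
under [LHS]eq_bigr do rewrite TA IH (linD (lA _)) -addrA.
rewrite big_split /=; congr (_ + _); rewrite big_split /=.
rewrite -natr1 mulrDr mulr1 scalerDl.
have -> : \sum_(i < n) A i (if (j <= n - i.+1)%N then
    (c * k%:R) *: pow_coef A k.-1 (n - i.+1 - j) x else 0) =
  if (j <= n)%N then (c * k%:R) *: pow_coef A k (n - j) x else 0.
  case: k {IH} => [|k].
    rewrite mulr0 scale0r if_same big1 // => i _.
    by rewrite scale0r if_same lin0.
  case: ifP => jn; last first.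
    by apply: big1 => i _; rewrite ifF ?lin0 //; lia.
  rewrite /= scaler_sumr [RHS](big_ord_widen n (fun i => (c * k.+1%:R) *:
    A i (pow_coef A k (n - j - i.+1) x))); last by lia.
  rewrite [RHS]big_mkcond; apply: eq_bigr => i _.
  have -> : (i < n - j)%N = (j <= n - i.+1)%N by have := ltn_ord i; lia.
  case: ifP => _; last by rewrite lin0.
  by rewrite linZ //; congr (_ *: A i (pow_coef _ _ _ _)); lia.
have -> : \sum_(i < n) (if i.+1 == j then c *: pow_coef A k (n - i.+1) x else 0)
   = if (j <= n)%N then c *: pow_coef A k (n - j) x else 0.
  case: ifP => jn; last by apply: big1 => i _; rewrite ifF //; have := ltn_ord i; lia.
  have jn' : (j.-1 < n)%N by lia.
  rewrite (bigD1 (Ordinal jn')) //= prednK // eqxx big1 ?addr0 // => i ij.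
  by rewrite ifF //; apply: contra_neqF ij => /eqP ij; apply: val_inj; rewrite /=; lia.
by case: ifP => _; rewrite ?addr0.
Qed.

(** [T, exp A(z)] = c z^j exp A(z), the sum of the previous identities divided
    by k!. *)
Lemma exp_coef_ad n x : T (exp_coef A n x) = exp_coef A n (T x) +
  (if (j <= n)%N then c *: exp_coef A (n - j) x else 0).
Proof.
rewrite /exp_coef (lin_sum _ _ _ lT).
under [LHS]eq_bigr do rewrite (linZ _ lT) pow_coef_ad scalerDr.
rewrite big_split /=; congr (_ + _).
case: ifP => jn; last by apply: big1 => i _; rewrite scaler0.
(* the term k = 0 has no commutator, and 1/k! * k = 1/(k-1)! for the others *)
rewrite big_ord_recl mulr0 scale0r scaler0 add0r scaler_sumr.
rewrite [RHS](big_ord_widen n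
  (fun k => c *: ((k`!)%:R^-1 *: pow_coef A k (n - j) x))); last by lia.
rewrite [RHS]big_mkcond; apply: eq_bigr => i _; rewrite /= /bump add1n.
case: ifP => ij; last by rewrite pow_coef_small ?scaler0 //; lia.
rewrite !scalerA factS natrM invfM mulrC -mulrA mulVKf ?pnatr_eq0 //.
Qed.

End Exponential.

Section ExpSeries.
Context {K : numFieldType} {V : lmodType K}.

(** Extension by 0 to negative exponents, so that a multiplication by z^j can be
    written as a shift of the index. *)
Definition exp_series (A : nat -> V -> V) (i : int) (x : V) : V :=
  if i is Posz n then exp_coef A n x else 0.

Lemma exp_series_ge0 A i x : 0 <= i -> exp_series A i x = exp_coef A `|i| x.
Proof. by case: i. Qed.

Lemma exp_series_lt0 A i x : i < 0 -> exp_series A i x = 0.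
Proof. by case: i. Qed.

Lemma exp_series_lin A i : (forall k, linear (A k)) -> linear (exp_series A i).
Proof.
by case: i => n lA; [exact: exp_coef_lin | move=> c x y; rewrite scaler0 addr0].
Qed.

Lemma exp_series_ad A T (c : K) (j : nat) i x : (forall k, linear (A k)) ->
  linear T -> (0 < j)%N ->
  (forall k y, T (A k y) = A k (T y) + (if k.+1 == j then c *: y else 0)) ->
  T (exp_series A i x) = exp_series A i (T x) + c *: exp_series A (i - j%:Z) x.
Proof.
move=> lA lT j0 TA; case: i => n; last first.
  have -> : Negz n - j%:Z = Negz (n + j) by lia.
  by rewrite /= lin0 // scaler0 addr0.
rewrite [LHS](exp_coef_ad lA lT j0 TA); congr (_ + _); case: ifP => jn.
  by have -> : n%:Z - j%:Z = (n - j)%N%:Z by lia.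
have -> : n%:Z - j%:Z = Negz (j - n).-1 by lia.
by rewrite /= scaler0.
Qed.

Lemma exp_series_comm A T i x : (forall k, linear (A k)) -> linear T ->
  (forall k y, T (A k y) = A k (T y)) ->
  T (exp_series A i x) = exp_series A i (T x).
Proof.
move=> lA lT TA; rewrite (@exp_series_ad A T 0 1) // ?scale0r ?addr0 //.
by move=> k y; rewrite scale0r if_same addr0 TA.
Qed.

End ExpSeries.

(** * Operators on the Fock space *)
Lemma malgU_scale {R : nzRingType} {T : choiceType} (c : R) (k : T) :
  << c *g k >> = c *: << k >> :> {malg R[T]}.
Proof. by apply/malgP => l; rewrite mcoeffZ !mcoeffU mulr_natr. Qed.

Section FockOperators.
Context {K : fieldType} {N : nat}.
Local Notation fock := (@fock K N).
Local Notation bvec := (@bvec N).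
Local Notation gen := (@gen N).
Local Notation zvec := (@zvec N).
Implicit Types (b : bvec) (s r : zvec) (m : {mset gen}%mset) (w : {fset gen})
  (g h : gen) (x y : fock).

Lemma lin_ext_widen (f : bvec -> fock) x (d : {fset bvec}) : (msupp x `<=` d)%fset ->
  lin_ext f x = \sum_(b <- d) x@_b *: f b.
Proof.
move=> xd; apply: big_fset_incl => // b _ /mcoeff_outdom ->.
by rewrite scale0r.
Qed.

Lemma lin_ext_lin (f : bvec -> fock) : linear (lin_ext f).
Proof.
move=> c x y; set d := (msupp x `|` msupp y `|` msupp (c *: x + y))%fset.
rewrite !(@lin_ext_widen _ _ d); last first.
- exact: fsubsetUr.
- by apply: fsubset_trans (fsubsetUl _ _); exact: fsubsetUl.
- by apply: fsubset_trans (fsubsetUl _ _); exact: fsubsetUr.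
rewrite scaler_sumr -big_split /=; apply: eq_bigr => b _.
by rewrite mcoeffD mcoeffZ scalerDl scalerA.
Qed.

Lemma lin_extU (f : bvec -> fock) b : lin_ext f << b >> = f b.
Proof.
rewrite /lin_ext msuppU oner_eq0 big_seq_fset1 mcoeffU eqxx scale1r //.
Qed.

Lemma lin_extZ (f : bvec -> fock) (c : K) x : lin_ext f (c *: x) = c *: lin_ext f x.
Proof. exact: (linZ _ (lin_ext_lin f)). Qed.

(** The basis vectors may differ when the coefficient is 0, as happens for the
    derivative of a monomial in a variable which does not occur in it. *)
Lemma eq_scaleU (c c' : K) b b' : c = c' -> (c != 0 -> b = b') ->
  c *: << b >> = c' *: << b' >> :> fock.
Proof.
move=> <-; have [->|c0 -> //] := eqVneq c 0; by rewrite !scale0r.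
Qed.

Local Ltac on_basis := repeat first [rewrite -> lin_extU | rewrite -> lin_extZ];
  rewrite -> ?scalerA.

Lemma fock_expand x : x = \sum_(b <- msupp x) x@_b *: << b >>.
Proof.
by rewrite {1}[x]monalgE; apply: eq_bigr => b _; apply: malgU_scale.
Qed.

Lemma fock_ext (F G : fock -> fock) : linear F -> linear G ->
  (forall b, F << b >> = G << b >>) -> forall x, F x = G x.
Proof.
move=> lF lG FG x; rewrite [x]fock_expand !lin_sum //.
by apply: eq_bigr => b _; rewrite (linZ _ lF) (linZ _ lG) FG.
Qed.

(** Weighted maps of the basis labels that act on one of the three tensor
    factors only: the lattice part, the bosons, the fermions.  Operators on
    different factors commute. *)
Definition act_q (t : zvec -> K) (h : zvec -> zvec) : fock -> fock :=
  lin_ext (fun b => let: (s, m, w) := b in t s *: << (h s, m, w) >>).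
Definition act_b (t : {mset gen}%mset -> K) (h : {mset gen}%mset -> {mset gen}%mset)
  : fock -> fock :=
  lin_ext (fun b => let: (s, m, w) := b in t m *: << (s, h m, w) >>).
Definition act_f (t : {fset gen} -> K) (h : {fset gen} -> {fset gen})
  : fock -> fock :=
  lin_ext (fun b => let: (s, m, w) := b in t w *: << (s, m, h w) >>).

Definition acts_q (F : fock -> fock) := exists t H, F = act_q t H.
Definition acts_b (F : fock -> fock) := exists (c : K) t H, F = (fun x => c *: act_b t H x).
Definition acts_f (F : fock -> fock) := exists t H, F = act_f t H.

Lemma acts_q_lin F : acts_q F -> linear F.
Proof. by case=> t [h ->]; apply: lin_ext_lin. Qed.
Lemma acts_b_lin F : acts_b F -> linear F.
Proof.
case=> c [t [h ->]]; apply: (lin_comp (@lin_scale _ _ _)); exact: lin_ext_lin.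
Qed.
Lemma acts_f_lin F : acts_f F -> linear F.
Proof. by case=> t [h ->]; apply: lin_ext_lin. Qed.

Lemma acts_qb F G x : acts_q F -> acts_b G -> F (G x) = G (F x).
Proof.
move=> aF aG; move: x; apply: fock_ext.
- by apply: lin_comp; [exact: acts_q_lin | exact: acts_b_lin].
- by apply: lin_comp; [exact: acts_b_lin | exact: acts_q_lin].
case: aF aG => t [h ->] [c [t' [h' ->]]] [[s m] w].
rewrite /act_q /act_b /act_f; on_basis.
by apply: eq_scaleU => //; ring.
Qed.

Lemma acts_qf F G x : acts_q F -> acts_f G -> F (G x) = G (F x).
Proof.
move=> aF aG; move: x; apply: fock_ext.
- by apply: lin_comp; [exact: acts_q_lin | exact: acts_f_lin].
- by apply: lin_comp; [exact: acts_f_lin | exact: acts_q_lin].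
case: aF aG => t [h ->] [t' [h' ->]] [[s m] w].
rewrite /act_q /act_b /act_f; on_basis.
by apply: eq_scaleU => //; ring.
Qed.

Lemma acts_bf F G x : acts_b F -> acts_f G -> F (G x) = G (F x).
Proof.
move=> aF aG; move: x; apply: fock_ext.
- by apply: lin_comp; [exact: acts_b_lin | exact: acts_f_lin].
- by apply: lin_comp; [exact: acts_f_lin | exact: acts_b_lin].
case: aF aG => c [t [h ->]] [t' [h' ->]] [[s m] w].
rewrite /act_q /act_b /act_f; on_basis.
by apply: eq_scaleU => //; ring.
Qed.

Lemma eq_lin_ext (f f' : bvec -> fock) : f =1 f' -> lin_ext f = lin_ext f'.
Proof. by move=> /funext ->. Qed.

Lemma qmul_acts r : acts_q (qmul r).
Proof.
exists (fun=> 1), (fun s => s + r); apply: eq_lin_ext => -[[s m] w].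
by rewrite scale1r.
Qed.
Lemma qder_acts gamma p : acts_q (qder gamma p).
Proof. by exists (fun s => gamma p + (s p)%:~R), id. Qed.

Lemma act_b_acts t H (c : K) : acts_b (fun x => c *: act_b t H x).
Proof. by exists c, t, H. Qed.
Lemma bmul_act g : bmul g = act_b (fun=> 1) (fun m => (g +` m)%mset).
Proof. by apply: eq_lin_ext => -[[s m] w]; rewrite scale1r. Qed.
Lemma bmul_acts g (c : K) : acts_b (fun x => c *: bmul g x).
Proof. by rewrite bmul_act; apply: act_b_acts. Qed.
Lemma bder_acts g : acts_b (bder g).
Proof.
exists 1, (fun m => (m g)%:R), (fun m => (m `\ g)%mset).
by apply: funext => x; rewrite scale1r.
Qed.
Lemma zero_acts_b : acts_b (fun=> 0).
Proof. by exists 0, (fun=> 0), id; apply: funext => x; rewrite scale0r. Qed.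

Lemma fmul_acts g : acts_f (fmul g).
Proof.
exists (fun w => if g \in w then 0 else fsign g w), (fun w => (g |` w)%fset).
by apply: eq_lin_ext => -[[s m] w]; case: ifP => //; rewrite scale0r.
Qed.
Lemma fder_acts g : acts_f (fder g).
Proof.
exists (fun w => if g \in w then fsign g w else 0), (fun w => (w `\ g)%fset).
by apply: eq_lin_ext => -[[s m] w]; case: ifP => //; rewrite scale0r.
Qed.

Lemma bmul_lin g : linear (bmul g : fock -> fock). Proof. exact: lin_ext_lin. Qed.
Lemma bder_lin g : linear (bder g : fock -> fock). Proof. exact: lin_ext_lin. Qed.
Lemma fmul_lin g : linear (fmul g : fock -> fock). Proof. exact: lin_ext_lin. Qed.
Lemma fder_lin g : linear (fder g : fock -> fock). Proof. exact: lin_ext_lin. Qed.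
Lemma qmul_lin r : linear (qmul r : fock -> fock). Proof. exact: lin_ext_lin. Qed.
Lemma qder_lin gamma p : linear (qder gamma p : fock -> fock). Proof. exact: lin_ext_lin. Qed.

Lemma bmulC g h x : bmul g (bmul h x) = bmul h (bmul g x).
Proof.
move: x; apply: fock_ext; try by apply: lin_comp; apply: bmul_lin.
by move=> [[s m] w]; rewrite /bmul; on_basis; rewrite msetDCA.
Qed.

Lemma bderC g h x : bder g (bder h x) = bder h (bder g x).
Proof.
move: x; apply: fock_ext; try by apply: lin_comp; apply: bder_lin.
move=> [[s m] w]; rewrite /bder; on_basis.
apply: eq_scaleU.
  rewrite !msetB1E; case: (eqVneq g h) => [-> //|gh].
  by rewrite !subn0 mulrC.
move=> _; congr (s, _, w).
by apply/msetP => i; rewrite !msetB1E -!subnDA addnC.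
Qed.

(** Heisenberg relation: the multiplicity of g in g + m is one more than that
    of g in m. *)
Lemma bder_bmul g h x :
  bder g (bmul h x) = bmul h (bder g x) + (if g == h then x else 0).
Proof.
move: x; apply: fock_ext.
- by apply: lin_comp; [exact: bder_lin | exact: bmul_lin].
- apply: lin_add; first by apply: lin_comp; [exact: bmul_lin | exact: bder_lin].
  by case: (g == h) => c x y //; rewrite scaler0 addr0.
move=> [[s m] w]; rewrite /bder /bmul; on_basis; rewrite mset1DE.
case: eqVneq => [<-|gh]; last first.
  rewrite add0n addr0; apply: eq_scaleU => // m0; congr (s, _, w).
  apply/msetP => i.
  rewrite !(msetB1E, mset1DE); case: (eqVneq i g) => [->|ig]; last by rewrite !subn0.
  by rewrite (negbTE gh) add0n.
rewrite natrD; rewrite -> scalerDl, scale1r; rewrite [LHS]addrC; apply: (f_equal2 +%R).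
  apply: eq_scaleU => // m0; congr (s, _, w).
  apply/msetP => i.
  rewrite !(msetB1E, mset1DE); case: (eqVneq i g) => [->|ig]; last by rewrite !subn0.
  by move: m0; case: (m g) => [|k _]; [rewrite mulr0n eqxx | lia].
f_equal; congr (s, _, w); apply/msetP => i.
by rewrite !(msetB1E, mset1DE) addKn.
Qed.

Lemma qderC gamma p q x : qder gamma p (qder gamma q x) = qder gamma q (qder gamma p x) :> fock.
Proof.
move: x; apply: fock_ext; try by apply: lin_comp; apply: qder_lin.
by move=> [[s m] w]; rewrite /qder; on_basis; apply: eq_scaleU => //; ring.
Qed.

Lemma qder_qmul gamma p r x :
  qder gamma p (qmul r x) = qmul r (qder gamma p x) + (r p)%:~R *: qmul r x :> fock.
Proof.
move: x; apply: fock_ext.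
- by apply: lin_comp; [exact: qder_lin | exact: qmul_lin].
- apply: lin_add; first by apply: lin_comp; [exact: qmul_lin | exact: qder_lin].
  by apply: (lin_comp (@lin_scale _ _ _)); apply: qmul_lin.
move=> [[s m] w]; rewrite /qder /qmul; on_basis; rewrite -[RHS]scalerDl ffunE intrD.
by rewrite addrA.
Qed.

(** The order of the factors of a wedge product. *)
Definition glt g h : bool := (choice.pickle g < choice.pickle h)%N.

Lemma glt_neq g h : g != h -> glt g h = ~~ glt h g.
Proof.
rewrite /glt -leqNgt ltn_neqAle => gh; case: eqP => // /(pcan_inj choice.pickleK) e.
by rewrite e eqxx in gh.
Qed.

Lemma fsignU g h w : h \notin w ->
  fsign g (h |` w)%fset = (-1) ^+ glt h g * fsign g w :> K.
Proof.
move=> hw; rewrite /fsign -/(glt _ _); set P := fun k => glt k g.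
have -> : [fset k in (h |` w)%fset | P k]%fset =
    (if P h then h |` [fset k in w | P k] else [fset k in w | P k])%fset.
  apply/fsetP => k; case: ifP => Ph; rewrite !inE; case: (eqVneq k h) => [->|kh] //=.
  by rewrite Ph andbF.
rewrite -/(P h); case: ifP => _; last by rewrite expr0 mul1r.
by rewrite cardfsU1 !inE (negbTE hw) /= exprD.
Qed.

Lemma fsignD g h w : h \in w ->
  fsign g (w `\ h)%fset = (-1) ^+ glt h g * fsign g w :> K.
Proof.
move=> hw; rewrite -{2}(fsetD1K hw) fsignU ?inE ?eqxx //.
by rewrite mulrA -expr2 sqrr_sign mul1r.
Qed.

Lemma gltxx g : glt g g = false. Proof. exact: ltnn. Qed.

Lemma fsign_sqr g w : fsign g w * fsign g w = 1 :> K.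
Proof. by rewrite /fsign -expr2 sqrr_sign. Qed.

Lemma fock_scaler0 (c : K) : c *: (0 : fock) = 0. Proof. exact: scaler0. Qed.

Lemma lin_ext0 (f : bvec -> fock) : lin_ext f 0 = 0.
Proof. exact: (lin0 (lin_ext_lin f)). Qed.

Lemma glt_sign g h : g != h -> (-1) ^+ glt g h = - (-1) ^+ glt h g :> K.
Proof. by move=> /glt_neq ->; case: glt; rewrite ?expr0 ?expr1 ?opprK. Qed.

Lemma opp_scaleU (c : K) b : - (c *: << b >>) = (- c) *: << b >> :> fock.
Proof. by rewrite scaleNr. Qed.

Lemma lin_opp (F : fock -> fock) : linear F -> linear (fun x => - F x).
Proof. by move=> lF c x y; rewrite lF opprD scalerN. Qed.

Local Ltac fock0 := rewrite -> ?lin_ext0, ?fock_scaler0.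

(** The signs count the generators to be crossed; creating g first changes by
    one the number for h exactly if g comes before h, and g and h exchange
    roles in the other order, so exactly one of the two signs changes. *)
Lemma fmul_anti g h x : fmul g (fmul h x) = - fmul h (fmul g x).
Proof.
move: x; apply: fock_ext.
- by apply: lin_comp; apply: fmul_lin.
- by apply: lin_opp; apply: lin_comp; apply: fmul_lin.
move=> [[s m] w]; rewrite /fmul; on_basis.
have [->|gh] := eqVneq g h.
  case hw: (h \in w); first by fock0; rewrite ?oppr0.
  by on_basis; rewrite !inE eqxx /=; fock0; rewrite ?oppr0.
have hg : h != g by rewrite eq_sym.
case hw: (h \in w); case gw: (g \in w); fock0 => //; on_basis.
- by rewrite oppr0.
- by rewrite !inE hw orbT; fock0; rewrite ?oppr0.
- by rewrite !inE gw orbT; fock0; rewrite ?oppr0.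
rewrite !inE (negbTE gh) (negbTE hg) gw hw /=; on_basis; rewrite opp_scaleU.
apply: eq_scaleU => [|_]; last by rewrite fsetUCA.
rewrite !fsignU ?gw ?hw // (glt_sign hg).
ring.
Qed.

Lemma fder_anti g h x : fder g (fder h x) = - fder h (fder g x).
Proof.
move: x; apply: fock_ext.
- by apply: lin_comp; apply: fder_lin.
- by apply: lin_opp; apply: lin_comp; apply: fder_lin.
move=> [[s m] w]; rewrite /fder; on_basis.
have [->|gh] := eqVneq g h.
  case hw: (h \in w); last by fock0; rewrite ?oppr0.
  by on_basis; rewrite !inE eqxx /=; fock0; rewrite ?oppr0.
have hg : h != g by rewrite eq_sym.
case hw: (h \in w); case gw: (g \in w); fock0 => //; on_basis.
- rewrite !inE gh hg gw hw /=; on_basis; rewrite opp_scaleU.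
  apply: eq_scaleU => [|_]; last by rewrite !fsetDDl fsetUC.
  by rewrite !fsignD // (glt_sign hg); ring.
- by rewrite !inE gw andbF; fock0; rewrite ?oppr0.
- by rewrite !inE hw andbF; fock0; rewrite ?oppr0.
- by rewrite oppr0.
Qed.

(** For g = h exactly one of the two products is nonzero, according to whether g
    occurs in the wedge product, and its two signs cancel. *)
Lemma fder_fmul g h x :
  fder g (fmul h x) = - fmul h (fder g x) + (if g == h then x else 0).
Proof.
move: x; apply: fock_ext.
- by apply: lin_comp; [exact: fder_lin | exact: fmul_lin].
- apply: lin_add.
    by apply: lin_opp; apply: lin_comp; [exact: fmul_lin | exact: fder_lin].
  by case: (g == h) => c x y //; rewrite scaler0 addr0.
move=> [[s m] w]; rewrite /fder /fmul; on_basis.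
have [->|gh] := eqVneq g h.
  case hw: (h \in w); fock0; on_basis; rewrite !inE eqxx /=.
    rewrite fsignD // gltxx expr0 mul1r; on_basis.
    by rewrite fsign_sqr scale1r fsetD1K // addNr.
  rewrite fsignU ?hw // gltxx expr0 mul1r; on_basis.
  by rewrite fsign_sqr scale1r fsetU1K ?hw // oppr0 add0r.
have hg : h != g by rewrite eq_sym.
rewrite addr0; case hw: (h \in w); case gw: (g \in w); fock0 => //; on_basis.
- by rewrite !inE hg hw /=; fock0; rewrite ?oppr0.
- by rewrite oppr0.
- rewrite !inE (negbTE gh) hg gw hw /=; on_basis; rewrite opp_scaleU.
  apply: eq_scaleU => [|_].
    by rewrite fsignU ?hw // fsignD // (glt_sign hg); ring.
  congr (s, m, _); apply/fsetP => k; rewrite !inE.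
  by case: (eqVneq k g) => //= ->; rewrite (negbTE gh).
- by rewrite !inE (negbTE gh) gw; fock0; rewrite ?oppr0.
Qed.

End FockOperators.

(** * Weights and fermionic degrees *)
Section Support.
Context {K : fieldType} {N : nat}.
Local Notation fock := (@fock K N).
Local Notation bvec := (@bvec N).
Local Notation gen := (@gen N).
Implicit Types (b : bvec) (m : {mset gen}%mset) (w : {fset gen}) (g h : gen)
  (x y : fock) (S : bvec -> Prop).

Definition supported S x := forall b, b \in msupp x -> S b.

Lemma supported0 S : supported S 0.
Proof. by move=> b; rewrite msupp0. Qed.

Lemma supportedD S x y : supported S x -> supported S y -> supported S (x + y).
Proof.
move=> Sx Sy b /(fsubsetP (msuppD_le x y)); rewrite in_fsetU => /orP[/Sx|/Sy] //.
Qed.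

Lemma supportedZ S (c : K) x : supported S x -> supported S (c *: x).
Proof. by move=> Sx b /(fsubsetP (msuppZ_le c x)) /Sx. Qed.

Lemma supported_sum S I (r : seq I) (P : pred I) (F : I -> fock) :
  (forall i, supported S (F i)) -> supported S (\sum_(i <- r | P i) F i).
Proof.
move=> SF; apply: big_ind => [|x y|i _]; [exact: supported0| exact: supportedD|].
exact: SF.
Qed.

Lemma supported_fsbig S (I : choiceType) (A : set I) (F : I -> fock) :
  (forall i, supported S (F i)) -> supported S (\sum_(i \in A) F i).
Proof. by move=> SF; apply: supported_sum. Qed.

Lemma supported_zsum S (F : int -> fock) :
  (forall i, supported S (F i)) -> supported S (zsum F).
Proof. exact: supported_fsbig. Qed.

Lemma supportedN S x : supported S x -> supported S (- x).
Proof. by move=> Sx b; rewrite msuppN; apply: Sx. Qed.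

Lemma supportedU S (c : K) b : (c != 0 -> S b) -> supported S (c *: << b >>).
Proof.
move=> Sb b'; have [->|c0] := eqVneq c 0; first by rewrite scale0r msupp0.
by move/(fsubsetP (msuppZ_le _ _)); rewrite msuppU oner_eq0 inE => /eqP->; apply: Sb.
Qed.

Lemma supported_lin_ext S S' (f : bvec -> fock) x :
  (forall b, S b -> supported S' (f b)) -> supported S x ->
  supported S' (lin_ext f x).
Proof.
move=> Sf Sx; rewrite /lin_ext big_seq; apply: big_ind => [|y z|b /Sx Sb].
- exact: supported0.
- exact: supportedD.
- by apply: supportedZ; apply: Sf.
Qed.

Definition gidx g : nat := match g with inl pk => pk.2 | inr pk => pk.2 end.

(** The degree of a monomial in the u_{pj}, v_{pj}, both counted with degree j. *)
Definition mweight m : nat := (\sum_(g <- finsupp m) m g * (gidx g).+1)%N.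

Lemma mweight_widen m (d : {fset gen}) : (finsupp m `<=` d)%fset ->
  mweight m = (\sum_(g <- d) m g * (gidx g).+1)%N.
Proof.
move=> md; apply: big_fset_incl => // g _ gm.
by rewrite fsfun_dflt.
Qed.

Lemma mweightB1 m g : m g != 0%N -> mweight m = (mweight (m `\ g)%mset + (gidx g).+1)%N.
Proof.
move=> mg; rewrite (@mweight_widen (m `\ g)%mset (finsupp m)); last first.
  apply/fsubsetP => h; rewrite !mem_finsupp msetB1E.
  by apply: contraNneq => ->.
have gm : g \in finsupp m by rewrite mem_finsupp.
rewrite /mweight !(big_fsetD1 g gm) /= msetB1E eqxx.
have -> : (\sum_(i <- (finsupp m `\ g)%fset) (m `\ g)%mset i * (gidx i).+1
  = \sum_(i <- (finsupp m `\ g)%fset) m i * (gidx i).+1)%N.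
  apply: eq_big_seq => i; rewrite !inE => /andP[ig _].
  by rewrite msetB1E (negbTE ig) subn0.
by case: (m g) mg => // k _; rewrite subn1 /= mulSn; lia.
Qed.

(** Weight at most W - n: the truncated subtraction would not distinguish
    n = W from n > W, where no basis vector is left. *)
Definition weight_below W n : bvec -> Prop := fun b => (mweight b.1.2 + n <= W)%N.

Lemma weight_below_eq0 W n x : (W < n)%N -> supported (weight_below W n) x -> x = 0.
Proof.
move=> Wn Sx; apply/malgP => b; rewrite mcoeff0 mcoeff_outdom //.
by apply/negP => /Sx; rewrite /weight_below; lia.
Qed.

Lemma bder_weight W n g x : supported (weight_below W n) x ->
  supported (weight_below W (n + (gidx g).+1)) (bder g x).
Proof.
apply: supported_lin_ext => -[[s m] w]; rewrite /weight_below /= => mn.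
apply: supportedU => mg; rewrite /= ; move: mn; rewrite (@mweightB1 m g); first lia.
by apply: contraNneq mg => ->.
Qed.

(** The sum of the weights is used as a bound on their maximum. *)
Lemma weight_bounded x : exists W, supported (weight_below W 0) x.
Proof.
exists (\sum_(b <- msupp x) mweight b.1.2)%N => b bx.
rewrite /weight_below addn0 (big_fsetD1 b bx) /=; exact: leq_addr.
Qed.

Lemma bder_eventually0 x : exists W : nat, forall g, (W <= gidx g)%N -> bder g x = 0.
Proof.
have [W hW] := weight_bounded x; exists W => g Wg.
by apply: (@weight_below_eq0 W (0 + (gidx g).+1)); [lia | apply: bder_weight].
Qed.

(** A vector involves finitely many fermionic generators. *)
Lemma fder_eventually0 x : exists W : nat, forall g, (W <= gidx g)%N -> fder g x = 0.
Proof.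
exists (\sum_(b <- msupp x) \sum_(h <- b.2) (gidx h).+1)%N => g Wg.
rewrite /fder /lin_ext big_seq; apply: big1 => -[[s m] w] bx.
rewrite ifF; first exact: scaler0.
apply: contraTF Wg => gw; rewrite -ltnNge.
by rewrite (big_fsetD1 (s, m, w) bx) /= (big_fsetD1 g gw) /=; lia.
Qed.

Definition gdeg g : int := if g is inl _ then 1 else -1.

Lemma bmul_deg k g x : fock_deg k x -> fock_deg k (bmul g x).
Proof.
apply: supported_lin_ext => -[[s m] w] bk; rewrite -[X in supported _ X]scale1r.
exact: supportedU.
Qed.

Lemma bder_deg k g x : fock_deg k x -> fock_deg k (bder g x).
Proof.
by apply: supported_lin_ext => -[[s m] w] bk; apply: supportedU.
Qed.

Lemma qmul_deg k r x : fock_deg k x -> fock_deg k (qmul r x).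
Proof.
apply: supported_lin_ext => -[[s m] w] bk; rewrite -[X in supported _ X]scale1r.
exact: supportedU.
Qed.

Lemma qder_deg gamma p k x : fock_deg k x -> fock_deg k (qder gamma p x).
Proof.
by apply: supported_lin_ext => -[[s m] w] bk; apply: supportedU.
Qed.

Lemma fmul_deg k g x : fock_deg k x -> fock_deg (k + gdeg g) (fmul g x).
Proof.
apply: supported_lin_ext => -[[s m] w] bk; case: ifP => gw; first exact: supported0.
by apply: supportedU => _; rewrite /Defs.fdeg /= big_fsetU1 ?gw //= addrC -bk.
Qed.

Lemma fder_deg k g x : fock_deg k x -> fock_deg (k - gdeg g) (fder g x).
Proof.
apply: supported_lin_ext => -[[s m] w] bk; case: ifP => gw; last exact: supported0.
apply: supportedU => _; rewrite /Defs.fdeg -bk /Defs.fdeg /= (big_fsetD1 g gw) /= -/(gdeg g).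
by rewrite addrAC subrr add0r.
Qed.

End Support.

(** * The generating fields *)
Section ScaledCommutation.
Context {K : fieldType} {V : lmodType K}.

Lemma scale_commD (F G : V -> V) (d : K) x y : linear F ->
  F (G x) = G (F x) + y -> F (d *: G x) = d *: G (F x) + d *: y.
Proof. by move=> lF FG; rewrite (linZ _ lF) FG scalerDr. Qed.

Lemma scale_commr (F G : V -> V) (d : K) x : linear F ->
  F (G x) = G (F x) -> F (d *: G x) = d *: G (F x).
Proof. by move=> lF FG; rewrite (linZ _ lF) FG. Qed.

Lemma scale_comm (F G : V -> V) (c d : K) x : linear F -> linear G ->
  F (G x) = G (F x) -> c *: F (d *: G x) = d *: G (c *: F x).
Proof.
by move=> lF lG FG; rewrite (linZ _ lF) (linZ _ lG) FG !scalerA mulrC.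
Qed.

End ScaledCommutation.

Section Generators.
Context {K : numFieldType} {N : nat} (gamma : {ffun 'I_N -> K}).
Local Notation fock := (@fock K N).
Local Notation u := (@u K N).
Local Notation v := (@v K N gamma).
Local Notation phi := (@phi K N).
Local Notation psi := (@psi K N).
Implicit Types (x y : fock) (p q : 'I_N) (j k : int).

Lemma u_acts p j : acts_b (u p j).
Proof.
case: j => [[|j]|j]; [exact: zero_acts_b | exact: bder_acts | exact: bmul_acts].
Qed.

(** The zero mode of v acts on the lattice part, the others on the bosons. *)
Lemma v_acts p j : acts_q (v p j) \/ acts_b (v p j).
Proof.
case: j => [[|j]|j]; [left; exact: qder_acts | right; exact: bder_acts | right].
exact: bmul_acts.
Qed.

Lemma phi_acts p j : acts_f (phi p j).
Proof. case: j => j; [exact: fder_acts | exact: fmul_acts]. Qed.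

Lemma psi_acts p j : acts_f (psi p j).
Proof. case: j => j; [exact: fder_acts | exact: fmul_acts]. Qed.

Lemma field_u p : field (u p).
Proof.
split=> [j|x]; first exact/acts_b_lin/u_acts.
have [W hW] := bder_eventually0 x; exists (W%:Z + 1) => -[[|j]|j] hj //.
by apply: hW => /=; lia.
Qed.

Lemma field_v p : field (v p).
Proof.
split=> [j|x]; first by case: (v_acts p j) => [/acts_q_lin|/acts_b_lin].
have [W hW] := bder_eventually0 x; exists (W%:Z + 1) => -[[|j]|j] hj //.
- by exfalso; move: hj; lia.
- by apply: hW => /=; lia.
Qed.

Lemma field_phi p : field (phi p).
Proof.
split=> [j|x]; first exact/acts_f_lin/phi_acts.
have [W hW] := fder_eventually0 x; exists W%:Z => -[j|j] hj.
  by apply: hW => /=; lia.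
by exfalso; move: hj; lia.
Qed.

Lemma field_psi p : field (psi p).
Proof.
split=> [j|x]; first exact/acts_f_lin/psi_acts.
have [W hW] := fder_eventually0 x; exists W%:Z => -[j|j] hj.
  by apply: hW => /=; lia.
by exfalso; move: hj; lia.
Qed.

Lemma u_acts_f p j F x : acts_f F -> u p j (F x) = F (u p j x).
Proof. exact/acts_bf/u_acts. Qed.

Lemma v_acts_f p j F x : acts_f F -> v p j (F x) = F (v p j x).
Proof. by case: (v_acts p j) => [/acts_qf|/acts_bf]; apply. Qed.

Lemma uC p j q k x : u p j (u q k x) = u q k (u p j x).
Proof.
case: j => [[|j]|j]; case: k => [[|k]|k]; rewrite /u.
- by [].
- by rewrite (lin0 (bder_lin _)).
- by rewrite (lin0 (bmul_lin _)) scaler0.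
- by rewrite (lin0 (bder_lin _)).
- exact: bderC.
- by apply: scale_commr; [exact: bder_lin | rewrite bder_bmul addr0].
- by rewrite (lin0 (bmul_lin _)) scaler0.
- by symmetry; apply: scale_commr; [exact: bder_lin | rewrite bder_bmul addr0].
- by apply: scale_comm; [exact: bmul_lin | exact: bmul_lin | exact: bmulC].
Qed.

Lemma qder_bder p g x : qder gamma p (bder g x) = bder g (qder gamma p x).
Proof. by apply: acts_qb; [exact: qder_acts | exact: bder_acts]. Qed.

Lemma qder_zbmul p g (c : K) x :
  qder gamma p (c *: bmul g x) = c *: bmul g (qder gamma p x).
Proof. exact: (acts_qb _ (qder_acts gamma p) (bmul_acts g c)). Qed.

Lemma vC p j q k x : v p j (v q k x) = v q k (v p j x).
Proof.
case: j => [[|j]|j]; case: k => [[|k]|k]; rewrite /v.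
- exact: qderC.
- exact: qder_bder.
- exact: qder_zbmul.
- by symmetry; apply: qder_bder.
- exact: bderC.
- by apply: scale_commr; [exact: bder_lin | rewrite bder_bmul addr0].
- by symmetry; apply: qder_zbmul.
- by symmetry; apply: scale_commr; [exact: bder_lin | rewrite bder_bmul addr0].
- by apply: scale_comm; [exact: bmul_lin | exact: bmul_lin | exact: bmulC].
Qed.

Lemma v_u p j q k x : v p j (u q k x) = u q k (v p j x) +
  (if (p == q) && (j + k == 0) then j%:~R *: x else 0).
Proof.
case: j => [[|j]|j]; case: k => [[|k]|k]; rewrite /v /u; last 1 first.
- rewrite andbF addr0.
  by apply: scale_comm; [exact: bmul_lin | exact: bmul_lin | exact: bmulC].
- by rewrite scale0r if_same addr0; apply: (lin0 (qder_lin _ _)).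
- by rewrite scale0r if_same addr0; apply: qder_bder.
- by rewrite scale0r if_same addr0; apply: qder_zbmul.
- by rewrite andbF addr0; apply: (lin0 (bder_lin _)).
- by rewrite andbF addr0; apply: bderC.
- rewrite (scale_commD _ (bder_lin _) (bder_bmul _ _ _)); congr (_ + _).
  have -> : (j.+1%:Z + Negz k == 0) = (j == k) by rewrite NegzE; lia.
  have -> : (inl (p, j) == inl (q, k) :> @gen N) = (p == q) && (j == k) by [].
  by case: (p == q) => /=; rewrite ?scaler0 //; case: eqP => [->|_]; rewrite ?scaler0.
- by rewrite andbF addr0 (lin0 (bmul_lin _)); apply: scaler0.
- rewrite (scale_commD _ (bder_lin _) (bder_bmul _ _ _)) -addrA.
  have -> : (Negz j + k.+1%:Z == 0) = (j == k) by rewrite NegzE; lia.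
  have -> : (inr (q, k) == inr (p, j) :> @gen N) = (p == q) && (j == k).
    by rewrite eq_sym.
  rewrite -[LHS]addr0; congr (_ + _).
  case: ifP => _; last by rewrite scaler0 addr0.
  by rewrite -scalerDl NegzE mulrNz -pmulrn subrr scale0r.
Qed.

Lemma phi_anti p j q k x : phi p j (phi q k x) = - phi q k (phi p j x).
Proof.
case: j => j; case: k => k; rewrite /phi.
- exact: fder_anti.
- by rewrite fder_fmul addr0.
- by rewrite fder_fmul addr0 opprK.
- exact: fmul_anti.
Qed.

Lemma phi_psi p j q k x : phi p j (psi q k x) = - psi q k (phi p j x) +
  (if (p == q) && (j + k == -1) then x else 0).
Proof.
case: j => j; case: k => k; rewrite /phi /psi.
- by rewrite andbF addr0; apply: fder_anti.
- rewrite fder_fmul; congr (_ + _).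
  have -> : (j%:Z + Negz k == -1) = (j == k) by rewrite NegzE; lia.
  by have -> : (inr (p, j) == inr (q, k) :> @gen N) = (p == q) && (j == k) by [].
- rewrite fder_fmul opprD opprK -addrA.
  have -> : (Negz j + k%:Z == -1) = (j == k) by rewrite NegzE; lia.
  have -> : (inl (q, k) == inl (p, j) :> @gen N) = (p == q) && (j == k).
    by rewrite eq_sym.
  by rewrite addNr addr0.
- have -> : (Negz j + Negz k == -1) = false by rewrite !NegzE; lia.
  by rewrite andbF addr0; apply: fmul_anti.
Qed.

End Generators.

(** * The vertex operators *)
Section VertexOperator.
Context {K : numFieldType} {N : nat} (gamma : {ffun 'I_N -> K}).
Local Notation fock := (@fock K N).
Local Notation u := (@u K N).
Local Notation v := (@v K N gamma).
Local Notation Y := (@Y K N).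
Local Notation vertexA := (@vertexA K N).
Local Notation vertexB := (@vertexB K N).
Implicit Types (x y : fock) (p q : 'I_N) (j n i : int) (r : @zvec N).

Lemma vertexA_lin r k : linear (vertexA r k).
Proof.
apply: lin_sum_fun => p; apply: (lin_comp (@lin_scale _ _ _)).
by apply: field_lin; apply: field_u.
Qed.

Lemma vertexB_lin r k : linear (vertexB r k).
Proof.
apply: lin_opp; apply: lin_sum_fun => p; apply: (lin_comp (@lin_scale _ _ _)).
by apply: field_lin; apply: field_u.
Qed.

(** The coefficient of z^(-n) in B(z)^k lowers the weight by n. *)
Lemma exp_vertexB_eventually0 r x : exists W : nat, forall n : nat, (W < n)%N ->
  exp_coef (vertexB r) n x = 0.
Proof.
have [W hW] := weight_bounded x; exists W => n Wn.
apply: (@weight_below_eq0 _ _ W (0 + n)); first by rewrite add0n.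
apply: (@exp_coef_closed _ _ _ (fun m y => supported (weight_below W m) y)) hW.
- by move=> m; apply: supported0.
- by move=> m y z; apply: supportedD.
- by move=> m c y; apply: supportedZ.
- move=> i m y Sy; apply: supportedN; apply: supported_sum => p; apply: supportedZ.
  exact: (@bder_weight _ _ W m (inr (p, i))).
Qed.

Lemma exp_series_vertexB_eventually0 r x : exists W : nat, forall i, (i < 0) || (W%:Z < i) ->
  exp_series (vertexB r) i x = 0.
Proof.
have [W hW] := exp_vertexB_eventually0 r x; exists W => -[i|i] //= hi.
by apply: hW; lia.
Qed.

(** The pairs of exponents are indexed by the second one; the first one is then
    determined, and [exp_series] gives 0 where it would be negative. *)
Lemma YE r n x : Y r n x = zsum (fun i =>
  qmul r (exp_series (vertexA r) (i - 1 - n) (exp_series (vertexB r) i x))).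
Proof.
pose P := [set i : int | (0 <= i) && (0 <= i - 1 - n)].
pose h i := (`|(i - 1 - n)%R|%N, `|i|%N).
rewrite /Defs.Y (@reindex_fsbig _ _ _ _ _ h P); last first.
  split.
  - by move=> i /= /andP[i0 in0]; lia.
  - by move=> i k; rewrite !inE /= => /andP[i0 _] /andP[k0 _] [_ ik]; lia.
  - move=> [a b] /= ab; exists b%:Z; first by apply/andP; split; lia.
    by rewrite /h; congr (_, _); lia.
rewrite zsum_cond; apply: eq_zsum => i.
have -> : (i \in P) = (0 <= i) && (0 <= i - 1 - n) by apply/idP/idP; rewrite in_setE.
have [h0|] := boolP ((0 <= i) && (0 <= i - 1 - n)).
  by case/andP: h0 => i0 in0; rewrite /h /= !exp_series_ge0.
rewrite negb_and -!ltNge => /orP[i0|in0].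
  rewrite (exp_series_lt0 _ _ i0) (lin0 (exp_series_lin _ (vertexA_lin r))).
  by rewrite (lin0 (qmul_lin r)).
by rewrite (exp_series_lt0 _ _ in0) (lin0 (qmul_lin r)).
Qed.

Lemma Yterm_lin r n i : linear (fun x =>
  qmul r (exp_series (vertexA r) (i - 1 - n) (exp_series (vertexB r) i x))).
Proof.
apply: (lin_comp (qmul_lin r)); apply: lin_comp; apply: exp_series_lin.
  exact: vertexA_lin.
exact: vertexB_lin.
Qed.

Lemma zbounded_Y r n x : zbounded (fun i =>
  qmul r (exp_series (vertexA r) (i - 1 - n) (exp_series (vertexB r) i x))).
Proof.
have [W hW] := exp_series_vertexB_eventually0 r x; exists 0, (W%:Z + 1) => i hi.
rewrite hW; last by lia.
by rewrite (lin0 (exp_series_lin _ (vertexA_lin r))) (lin0 (qmul_lin r)).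
Qed.

Lemma field_Y r : field (Y r).
Proof.
split=> [n c x y|x].
  rewrite !YE (zsum_lin (@lin_scale _ _ c) (zbounded_Y r n x)) -zsumD.
  - by apply: eq_zsum => i; apply: Yterm_lin.
  - by apply: zbounded_lin (zbounded_Y r n x); apply: lin_scale.
  - exact: zbounded_Y.
have [W hW] := exp_series_vertexB_eventually0 r x; exists W%:Z => n hn.
rewrite YE -[RHS](@zsum0 fock); apply: eq_zsum => i.
have [iW|iW] := lerP i W%:Z.
  by rewrite exp_series_lt0 ?(lin0 (qmul_lin r)) //; lia.
rewrite hW ?iW ?orbT //.
by rewrite (lin0 (exp_series_lin _ (vertexA_lin r))) (lin0 (qmul_lin r)).
Qed.

(** Y is built from q^r and the modes of the u's. *)
Lemma Y_comm r (F : fock -> fock) n x : linear F ->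
  (forall y, F (qmul r y) = qmul r (F y)) ->
  (forall p k y, F (u p k y) = u p k (F y)) ->
  F (Y r n x) = Y r n (F x).
Proof.
move=> lF Fq Fu; rewrite !YE (zsum_lin lF (zbounded_Y r n x)); apply: eq_zsum => i.
rewrite Fq; congr (qmul r _).
rewrite (exp_series_comm _ _ (vertexA_lin r) lF); last first.
  move=> k y; rewrite /Defs.vertexA (lin_sum _ _ _ lF); apply: eq_bigr => p _.
  by rewrite (linZ _ lF) Fu.
congr (exp_series _ _ _); apply: (exp_series_comm _ _ (vertexB_lin r) lF).
move=> k y; rewrite /Defs.vertexB (linN lF) (lin_sum _ _ _ lF); congr (- _).
by apply: eq_bigr => p _; rewrite (linZ _ lF) Fu.
Qed.

Lemma u_Y r p j n x : u p j (Y r n x) = Y r n (u p j x).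
Proof.
apply: Y_comm => [|y|q k y].
- by apply: field_lin; apply: field_u.
- by rewrite (acts_qb _ (qmul_acts r) (u_acts p j)).
- exact: uC.
Qed.

Lemma acts_f_Y r F n x : acts_f F -> F (Y r n x) = Y r n (F x).
Proof.
move=> aF; apply: Y_comm => [|y|q k y]; first exact: acts_f_lin.
  by rewrite (acts_qf _ (qmul_acts r) aF).
by rewrite (u_acts_f _ _ _ aF).
Qed.

(** The coefficient r_p / j of u_(-j) in A(z) is made to cancel the commutator
    [v_(j), u_(-j)] = j. *)
Lemma v_vertexA r p j k y : v p j (vertexA r k y) = vertexA r k (v p j y) +
  (if k.+1%:Z == j then (r p)%:~R *: y else 0).
Proof.
have lv : linear (v p j) by apply: field_lin; apply: field_v.
rewrite /Defs.vertexA (lin_sum _ _ _ lv).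
under [LHS]eq_bigr do rewrite (linZ _ lv) v_u scalerDr.
rewrite big_split /=; congr (_ + _); rewrite (bigD1 p) //= big1 ?addr0; last first.
  by move=> q qp; rewrite eq_sym (negbTE qp) scaler0.
rewrite eqxx /= subr_eq0 eq_sym; case: eqP => [<-|_]; last by rewrite scaler0.
by rewrite scalerA -pmulrn divfK // pnatr_eq0.
Qed.

Lemma v_vertexB r p j k y : v p j (vertexB r k y) = vertexB r k (v p j y) +
  (if k.+1%:Z == - j then (r p)%:~R *: y else 0).
Proof.
have lv : linear (v p j) by apply: field_lin; apply: field_v.
rewrite /Defs.vertexB (linN lv) (lin_sum _ _ _ lv).
under [in LHS]eq_bigr do rewrite (linZ _ lv) v_u scalerDr.
rewrite big_split /= opprD; congr (_ + _); rewrite (bigD1 p) //= big1 ?addr0; last first.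
  by move=> q qp; rewrite eq_sym (negbTE qp) scaler0.
rewrite eqxx /= addrC addr_eq0; case: eqP => [jk|_]; last by rewrite scaler0 oppr0.
have -> : j = - k.+1%:Z by rewrite jk opprK.
by rewrite scalerA mulrNz mulrN scaleNr opprK -pmulrn divfK // pnatr_eq0.
Qed.

Lemma v_qmul r p j y : v p j (qmul r y) = qmul r (v p j y) +
  (if j == 0 then (r p)%:~R *: qmul r y else 0).
Proof.
case: j => [[|j]|j]; rewrite /v /=.
- exact: qder_qmul.
- by rewrite addr0 (acts_qb _ (qmul_acts r) (bder_acts _)).
- by rewrite addr0 (acts_qb _ (qmul_acts r) (bmul_acts _ _)).
Qed.

Lemma v_exp_vertexA r p j i y :
  v p j (exp_series (vertexA r) i y) = exp_series (vertexA r) i (v p j y) +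
  (if 0 < j then (r p)%:~R *: exp_series (vertexA r) (i - j) y else 0).
Proof.
have lv : linear (v p j) by apply: field_lin; apply: field_v.
case: ifP => j0.
  have [k jk] : exists k : nat, j = k.+1%:Z by exists `|j|.-1%N; lia.
  rewrite [in X in _ + _ *: exp_series _ (i - X) _]jk.
  apply: (exp_series_ad _ _ (vertexA_lin r) lv) => // m z.
  by rewrite v_vertexA jk.
rewrite addr0; apply: (exp_series_comm _ _ (vertexA_lin r) lv) => m z.
by rewrite v_vertexA ifF ?addr0 //; apply/eqP; lia.
Qed.

Lemma v_exp_vertexB r p j i y :
  v p j (exp_series (vertexB r) i y) = exp_series (vertexB r) i (v p j y) +
  (if j < 0 then (r p)%:~R *: exp_series (vertexB r) (i + j) y else 0).
Proof.
have lv : linear (v p j) by apply: field_lin; apply: field_v.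
case: ifP => j0.
  have [k jk] : exists k : nat, j = - k.+1%:Z by exists `|j|.-1%N; lia.
  rewrite [in X in _ + _ *: exp_series _ (i + X) _]jk.
  apply: (exp_series_ad _ _ (vertexB_lin r) lv) => // m z.
  by rewrite v_vertexB jk opprK.
rewrite addr0; apply: (exp_series_comm _ _ (vertexB_lin r) lv) => m z.
by rewrite v_vertexB ifF ?addr0 //; apply/eqP; lia.
Qed.

(** Only one of the three factors of Y fails to commute with v_(j), and which
    one is decided by the sign of j. *)
Lemma v_Y r p j n x : v p j (Y r n x) = Y r n (v p j x) + (r p)%:~R *: Y r (n + j) x.
Proof.
have lv : linear (v p j) by apply: field_lin; apply: field_v.
have lq : linear (qmul r : fock -> fock) := qmul_lin r; have lA i := exp_series_lin i (vertexA_lin r).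
pose T m i y := qmul r (exp_series (vertexA r) (i - 1 - m) (exp_series (vertexB r) i y)).
have bT m y : zbounded (fun i => T m i y) by apply: zbounded_Y.
(* for j < 0 the second exponential is shifted by j, which reindexes the sum *)
pose s := if j < 0 then j else 0.
have vT i : v p j (T n i x) = T n i (v p j x) + (r p)%:~R *: T (n + j) (i + s) x.
  rewrite /T v_qmul v_exp_vertexA v_exp_vertexB (linD lq) (linD (lA _)) (linD lq) -!addrA.
  congr (_ + _); rewrite /s; case: (ltrgt0P j) => j0.
  - rewrite (lin0 (lA _)) (lin0 lq) add0r addr0 (linZ _ lq) addr0.
    by congr (_ *: qmul r (exp_series _ _ _)); lia.
  - rewrite (lin0 lq) !addr0 (linZ _ (lA _)) (linZ _ lq).
    by congr (_ *: qmul r (exp_series _ _ _)); lia.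
  - rewrite (lin0 (lA _)) !(lin0 lq) !add0r j0 !addr0.
    by [].
rewrite !YE (zsum_lin lv (bT n x)) (eq_zsum vT) zsumD.
- congr (_ + _); rewrite -(zsum_lin (@lin_scale _ _ _)); last first.
    have [m [M h]] := bT (n + j) x; exists (m - s), (M - s) => i hi.
    by apply: h; lia.
  exact: (f_equal (fun z => _ *: z) (esym (zsum_shift s (fun i => T (n + j) i x)))).
- exact: bT.
- apply: zbounded_lin; first exact: lin_scale.
  have [m [M h]] := bT (n + j) x; exists (m - s), (M - s) => i hi.
  by apply: h; lia.
Qed.

Lemma exp_vertex_deg (A : nat -> fock -> fock) k i x :
  (forall m k y, fock_deg k y -> fock_deg k (A m y)) ->
  fock_deg k x -> fock_deg k (exp_series A i x).
Proof.
case: i => i hA hx /=; last exact: supported0.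
apply: (@exp_coef_closed _ _ A (fun _ y => fock_deg k y) _ _ _ _ 0) hx.
- by move=> m; apply: supported0.
- by move=> m y z; apply: supportedD.
- by move=> m c y; apply: supportedZ.
- by move=> m n y; apply: hA.
Qed.

Lemma u_deg p j k x : fock_deg k x -> fock_deg k (u p j x).
Proof.
case: j => [[|j]|j] hx; first exact: supported0; first exact: bder_deg.
by apply: supportedZ; apply: bmul_deg.
Qed.

Lemma v_deg p j k x : fock_deg k x -> fock_deg k (v p j x).
Proof.
case: j => [[|j]|j] hx; first exact: qder_deg; first exact: bder_deg.
by apply: supportedZ; apply: bmul_deg.
Qed.

Lemma phi_deg p j k x : fock_deg k x -> fock_deg (k + 1) (phi p j x).
Proof.
by case: j => j hx; [apply: (fder_deg (g := inr _)) | apply: (fmul_deg (g := inl _))].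
Qed.

Lemma psi_deg p j k x : fock_deg k x -> fock_deg (k - 1) (psi p j x).
Proof.
by case: j => j hx; [apply: (fder_deg (g := inl _)) | apply: (fmul_deg (g := inr _))].
Qed.

Lemma Y_deg r n k x : fock_deg k x -> fock_deg k (Y r n x).
Proof.
move=> hx; rewrite YE; apply: supported_zsum => i; apply: qmul_deg.
apply: exp_vertex_deg => [m l y hy|].
  by apply: supported_sum => p; apply: supportedZ; apply: u_deg.
apply: exp_vertex_deg => // m l y hy.
by apply: supportedN; apply: supported_sum => p; apply: supportedZ; apply: u_deg.
Qed.

End VertexOperator.

(** * The homomorphism property *)
Section ExactOperators.
Context {K : fieldType} {V : lmodType K} (D : V -> V).
Context (lD : linear D) (DD : forall x, D (D x) = 0).

Lemma exact_comm (T X : V -> V) x : X 0 = 0 ->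
  (forall y, T y = D (X y) + X (D y)) -> D (T x) = T (D x).
Proof. by move=> X0 TX; rewrite !TX (linD lD) !DD X0 add0r addr0. Qed.

(** The fields of d_0 are minus a supercommutator, which is the supercommutator
    with the opposite operator. *)
Lemma opp_exact x y : - (D x + y) = D (- x) - y.
Proof. by rewrite (linN lD) opprD. Qed.

End ExactOperators.

Section ChiralDeRham.
Context {K : numFieldType} {N : nat} (gamma : {ffun 'I_N -> K}).
Local Notation fock := (@fock K N).
Local Notation u := (@u K N).
Local Notation v := (@v K N gamma).
Local Notation phi := (@phi K N).
Local Notation psi := (@psi K N).
Implicit Types (x y : fock) (p q : 'I_N) (j n k : int) (r : @zvec N).

Lemma u_phi p j q n x : u p j (phi q n x) = phi q n (u p j x).
Proof. exact/u_acts_f/phi_acts. Qed.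

Lemma u_psi p j q n x : u p j (psi q n x) = psi q n (u p j x).
Proof. exact/u_acts_f/psi_acts. Qed.

Lemma v_phi p j q n x : v p j (phi q n x) = phi q n (v p j x).
Proof. exact/v_acts_f/phi_acts. Qed.

Lemma v_psi p j q n x : v p j (psi q n x) = psi q n (v p j x).
Proof. exact/v_acts_f/psi_acts. Qed.

Lemma dR_lin : linear (dR gamma).
Proof. exact: diff_lin (field_v gamma) (@field_phi K N) v_phi. Qed.

Lemma dR_square x : dR gamma (dR gamma x) = 0.
Proof. 
exact: (diff_square (field_v gamma) (@field_phi K N) v_phi (@vC K N gamma) (@phi_anti K N)).
Qed.

Lemma dR_deg k x : fock_deg k x -> fock_deg (k + 1) (dR gamma x).
Proof.
move=> hx; apply: supported_sum => p; apply: supported_fsbig => j.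
by apply: v_deg; apply: phi_deg.
Qed.

Lemma nop_deg pa pb (a b : series fock) (da db : int) :
  (forall j k x, fock_deg k x -> fock_deg (k + da) (a j x)) ->
  (forall j k x, fock_deg k x -> fock_deg (k + db) (b j x)) ->
  forall n k x, fock_deg k x -> fock_deg (k + (da + db)) (nop pa pb a b n x).
Proof.
move=> ha hb n k x hx; apply: supportedD.
  apply: supported_fsbig => j; have -> : k + (da + db) = k + db + da by lia.
  by apply: ha; apply: hb.
apply: supportedZ; apply: supported_fsbig => j; rewrite addrA.
by apply: hb; apply: ha.
Qed.

(** The condition X 0 = 0 makes X D D vanish. *)
Definition dR_exact (T : fock -> fock) := exists X : fock -> fock,
  [/\ X 0 = 0, forall k x, fock_deg k x -> fock_deg (k - 1) (X x)
    & forall x, T x = dR gamma (X x) + X (dR gamma x)].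

Lemma dR_exact_deg T k x : dR_exact T -> fock_deg k x -> fock_deg k (T x).
Proof.
case=> X [_ dX ->] hx; apply: supportedD.
  by rewrite -[k](subrK 1); apply: dR_deg; apply: dX.
by rewrite -[k](addrK 1); apply: dX; apply: dR_deg.
Qed.

(** With D D = 0, both sides are D X D. *)
Lemma dR_exact_comm T x : dR_exact T -> dR gamma (T x) = T (dR gamma x).
Proof.
by case=> X [X0 _ TX]; apply: (exact_comm dR_lin dR_square _ X0 TX).
Qed.

Lemma field_d_dR_exact p r n : dR_exact (field_d gamma p r n).
Proof.
exists (nop true false (psi p) (Y r) n); split.
- by apply: field0; apply: field_nop; [exact: field_psi | exact: field_Y].
- move=> k x hx; rewrite -[-1]addr0; apply: nop_deg hx => [j|j] l y hy.
    exact: psi_deg.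
  by rewrite addr0; apply: Y_deg.
- exact: (field_d_exact (field_v gamma) (@field_phi K N) (@field_psi K N) v_phi
    v_psi (@phi_psi K N) (field_Y r) (fun p j k x => acts_f_Y r k x (phi_acts p j))
    (fun p j k x => acts_f_Y r k x (psi_acts p j))
    (fun p j k x => v_Y gamma r p j k x)).
Qed.

Lemma field_d0_dR_exact r n : dR_exact (field_d0 gamma r n).
Proof.
pose T : series fock := ssum (fun p => nop false true (u p) (psi p)).
have fT : field T.
  apply: field_ssum => p; apply: field_nop; [exact: field_u | exact: field_psi].
exists (fun x => - nop true false T (Y r) n x); split.
- by rewrite (field0 n (field_nop _ _ fT (field_Y r))) oppr0.
- move=> k x hx; apply: supportedN; rewrite -[-1]addr0; apply: nop_deg hx => [j|j] l y hy.
    apply: supported_sum => p; rewrite -[-1]add0r; apply: nop_deg hy => i m z hz.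
      by rewrite addr0; apply: u_deg.
    exact: psi_deg.
  by rewrite addr0; apply: Y_deg.
- move=> x; apply: etrans (opp_exact dR_lin _ _).
  exact: (field_d0_exact (@field_u K N) (field_v gamma) (@field_phi K N)
    (@field_psi K N) u_phi u_psi v_phi v_psi (@v_u K N gamma) (@phi_psi K N)
    (field_Y r) (u_Y r) (fun p j k x => acts_f_Y r k x (phi_acts p j))
    (fun p j k x => acts_f_Y r k x (psi_acts p j))
    (fun p j k x => v_Y gamma r p j k x)).
Qed.

Lemma act_gen_dR_exact a jr : dR_exact (act_gen gamma a jr).
Proof.
rewrite /act_gen; case: unlift => [p|]; first exact: field_d_dR_exact.
exact: field_d0_dR_exact.
Qed.

Lemma act_deg X k x : fock_deg k x -> fock_deg k (act gamma X x).
Proof.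
move=> hx; apply: supported_sum => a; apply: supported_sum => jr; apply: supportedZ.
exact: dR_exact_deg (act_gen_dR_exact a jr) hx.
Qed.

Lemma act_dR X x : dR gamma (act gamma X x) = act gamma X (dR gamma x).
Proof.
rewrite /act (lin_sum _ _ _ dR_lin); apply: eq_bigr => a _.
rewrite (lin_sum _ _ _ dR_lin); apply: eq_bigr => jr _.
apply: etrans (linZ _ dR_lin _) _.
exact: (f_equal _ (dR_exact_comm _ (act_gen_dR_exact a jr))).
Qed.

End ChiralDeRham.

Theorem theorem10p3 (R : realType) (N : nat) (N_gt0 : (0 < N)%N)
  (gamma : {ffun 'I_N -> R[i]}) (k : int) :
  vect_hom gamma (fock_deg k) (fock_deg (k + 1)) (dR gamma).
Proof.
split.
- by split=> X x; apply: act_deg.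
- by move=> x; apply: dR_deg.
- by move=> c x y _ _; apply: dR_lin.
- by move=> X x _; apply: act_dR.
Qed.
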